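(* Let $q$ be an odd prime power and $n>1$. A weak egg $\mathcal{E}$ of $\mathrm{PG}(4n-1,q)$ is classical if and only if there exists an element $E\in\mathcal{E}$ such that $\mathcal{E}$ is good at $E$ and there exists a $(3n-1)$-space, not containing $E$, which contains at least $5$ elements of $\mathcal{E}$.
   Context: $\mathrm{PG}(r,q)$ is the $r$-dimensional projective space over $\mathbb{F}_q$; dimensions are projective. A weak egg in $\mathrm{PG}(4n-1,q)$ is a set of $q^{2n}+1$ $(n-1)$-spaces such that any three of them span a $(3n-1)$-space. A weak egg $\mathcal{E}$ is good at $E\in\mathcal{E}$ if every $(3n-1)$-space containing $E$ and at least two other elements of $\mathcal{E}$ contains exactly $q^n+1$ elements of $\mathcal{E}$. Field reduction: viewing $\mathbb{F}_{q^n}^{r}$ as an $rn$-dimensional $\mathbb{F}_q$-vector space, each point of $\mathrm{PG}(r-1,q^n)$ corresponds to an $(n-1)$-space of $\mathrm{PG}(rn-1,q)$. A weak egg of $\mathrm{PG}(4n-1,q)$ is classical if it is obtained (up to choice of identification) by applying field reduction to the points of an elliptic quadric $Q^-(3,q^n)$ of $\mathrm{PG}(3,q^n)$. *)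

(* Defs.v *)
From HB Require Import structures.
From mathcomp Require Import all_boot all_order all_algebra all_field finmap.

Set Implicit Arguments.
Unset Strict Implicit.
Unset Printing Implicit Defensive.

Import GRing.Theory.
Local Open Scope ring_scope.

(* Subspaces of PG(m - 1, F) are represented by {vspace 'rV[F]_m}; a projective
   k-space is a vector subspace of dimension k + 1. *)

Section WeakEggs.
Variables (F : finFieldType) (n : nat).
Implicit Types (EE : {fset {vspace 'rV[F]_(4 * n)}}).
Implicit Types (E X Y Z S : {vspace 'rV[F]_(4 * n)}).

Definition weak_egg EE : Prop :=
  [/\ #|` EE| = (#|F| ^ (2 * n) + 1)%N,
      forall X, X \in EE -> \dim X = n
    & forall X Y Z, X \in EE -> Y \in EE -> Z \in EE ->
        X != Y -> X != Z -> Y != Z -> \dim (X + Y + Z) = (3 * n)%N].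

Definition elements_in EE S : {fset {vspace 'rV[F]_(4 * n)}} :=
  [fset X in EE | (X <= S)%VS]%fset.

Definition good_at EE E : Prop :=
  forall S, \dim S = (3 * n)%N -> (E <= S)%VS ->
    (2 <= #|` (elements_in EE S `\ E)%fset|)%N ->
    #|` elements_in EE S| = (#|F| ^ n + 1)%N.

End WeakEggs.

Section Quadrics.
Variables (L : fieldType) (m : nat).
Implicit Types (A : 'M[L]_m) (U : {vspace 'rV[L]_m}).

Definition quad_form A (v : 'rV[L]_m) : L := (v *m A *m v^T) 0 0.

(* A + A^T is the Gram matrix of the polar form
   Q(u + v) - Q(u) - Q(v) of Q = quad_form A. *)
Definition nondegenerate A : Prop := A + A^T \in unitmx.

Definition totally_singular A U : Prop :=
  forall v, v \in U -> quad_form A v = 0.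

Definition witt_index A (k : nat) : Prop :=
  (exists2 U, totally_singular A U & \dim U = k) /\
  (forall U, totally_singular A U -> (\dim U <= k)%N).

Definition quadric_point A U : Prop := \dim U = 1%N /\ totally_singular A U.

End Quadrics.

Definition elliptic (L : fieldType) (A : 'M[L]_4) : Prop :=
  nondegenerate A /\ witt_index A 1.

(* An identification of F^(r n) with L^r, viewed as an F-space by restriction
   of scalars along F -> L; bijectivity is imposed separately. *)
Notation reduction_map F L r n :=
  {linear 'rV[F]_(r * n) -> 'rV[L]_r | (in_alg L) \; *:%R}.

(* U is the F-subspace of F^(r n) corresponding to the L-subspace P of L^r. *)
Definition field_reduction (F : fieldType) (L : fieldExtType F) (r n : nat)
    (psi : reduction_map F L r n)
    (P : {vspace 'rV[L]_r}) (U : {vspace 'rV[F]_(r * n)}) : Prop :=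
  forall u, (u \in U) = (psi u \in P).

Definition classical_egg (F : finFieldType) (n : nat)
    (EE : {fset {vspace 'rV[F]_(4 * n)}}) : Prop :=
  exists (L : fieldExtType F) (psi : reduction_map F L 4 n) (A : 'M[L]_4),
    [/\ \dim {:L} = n, bijective psi, elliptic A
      & forall U, U \in EE <->
          exists2 P, quadric_point A P & field_reduction psi P U].

(* Main.v *)
(* Project a weak egg that is good at E from E.  Goodness makes the images of the
   other elements the points of an affine plane embedded in the subspaces of
   F^(3n); two parallel lines of it meet in the uncovered part of each, which
   provides coordinates in which the points are the pairs of matrices from a set
   closed under b + a (c - b).  Such a set is a finite division ring, hence a
   field L by Wedderburn, and the elements become
     E_(a,b) = {(t, t a, t b, g_(a,b)(t))},   E = {(0, 0, 0, t)},
   with g_(a,b) : L -> E linear over F.  Every functional on E turns g into a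
   function h on L^2 whose restriction to each line is the graph of an arc, for
   the egg condition on three collinear points (a,b) says precisely that.  In odd
   characteristic Segre's lemma of tangents makes h quadratic on lines, so h is
   the polynomial of a conic.

   Let S be complementary to E and contain five elements.  Taking S as the first
   three coordinates, every h vanishes at the same five points of L^2, of which no
   three are collinear, so all the h are multiples of one polynomial Q and
   g_(a,b)(t) = g(t Q(a,b)): the egg comes from the quadric x t = Q(x, y, z), which
   is elliptic because Q has no zeros at infinity.

   Conversely, a plane containing three points of an elliptic quadric meets it in
   a conic, which has q^n + 1 points. *)

Require Import Defs.
From HB Require Import structures.
From mathcomp Require Import all_boot all_order all_algebra all_field finmap.
From mathcomp Require Import ring zify.

Set Implicit Arguments.
Unset Strict Implicit.
Unset Printing Implicit Defensive.

Import GRing.Theory VectorInternalTheory.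
Local Open Scope ring_scope.

(** * Ovals and conics in odd characteristic *)

(** Translation by 1 permutes [K], so comparing the two sums over all elements gives [#|K|%:R = 0].
    If 2 were zero and [#|K|] odd, this would read 1 = 0. *)
Lemma odd_card_2neq0 (K : finFieldType) : odd #|K| -> (2 : K) != 0.
Proof.
move=> oK; have : #|K|%:R = 0 :> K.
  apply: (addrI (\sum_(x : K) x)); rewrite addr0 [RHS](reindex_inj (addIr 1)) /=.
  by rewrite big_split /= sumr_const.
rewrite -{1}(odd_double_half #|K|) oK natrD -muln2 natrM => e.
by apply: contraTneq isT => two0; rewrite two0 mulr0 addr0 in e; move/eqP: e; rewrite oner_eq0.
Qed.

Lemma fieldExt_2neq0 (F : fieldType) (L : fieldExtType F) : (2 : F) != 0 -> (2 : L) != 0.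
Proof. by rewrite -(rmorph_nat (in_alg L) 2) fmorph_eq0. Qed.

Lemma odd_card_gt2 (K : finFieldType) : odd #|K| -> (2 < #|K|)%N.
Proof.
by move=> oK; rewrite ltn_neqAle finNzRing_gt1 andbT; apply: contraL oK => /eqP<-.
Qed.

Section Segre.
Variables (K : finFieldType) (h : K -> K).
Hypothesis two_neq0 : (2 : K) != 0.
(** Up to sign this is the determinant with rows (1, x, h x), (1, y, h y), (1, z, h z): the graph of
    [h] is an arc, and the vertical point at infinity completes it to an oval. *)
Hypothesis noncollinear : forall x y z, x != y -> x != z -> y != z ->
  (y - z) * h x + (z - x) * h y + (x - y) * h z != 0.

Let slope x y := (h y - h x) / (y - x).

Let slopeC x y : slope x y = slope y x.
Proof. by rewrite /slope -opprB -(opprB x) invrN mulrNN. Qed.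

Let slope_inj x y z : x != y -> x != z -> slope x y = slope x z -> y = z.
Proof.
move=> xy xz /eqP; rewrite /slope eqr_div ?subr_eq0 1?eq_sym // => /eqP e.
apply: contraTeq isT => yz; have /negP[] := noncollinear xy xz yz.
apply/eqP; transitivity ((h y - h x) * (z - x) - (h z - h x) * (y - x)); first by ring.
by rewrite e subrr.
Qed.

(* The slope of the tangent at x is the only one missed by the secants at x. *)
Let tangent x : {t | [forall y, (x != y) ==> (slope x y != t)]}.
Proof.
apply: sigW; set A := [set slope x y | y in [set~ x]].
have: (#|A| < #|K|)%N.
  apply: leq_ltn_trans (leq_imset_card _ _) _.
  rewrite cardsC1 prednK //; apply/card_gt0P; by exists 0.
move=> ltA; have /set0Pn[t]: ~: A != set0.
  by rewrite -card_gt0 cardsCs setCK subn_gt0.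
rewrite inE => tA; exists t; apply/forallP=> y; apply/implyP=> xy.
apply: contraNneq tA => <-; apply: imset_f; by rewrite !inE eq_sym.
Qed.

Let t x := sval (tangent x).

Let slope_neq_tangent x y : x != y -> slope x y != t x.
Proof. by move=> xy; have /forallP/(_ y)/implyP-> := svalP (tangent x). Qed.

Let prod_units (u : K) : \prod_(w | w != u) (w - u) = \prod_(w : K | w != 0) w.
Proof.
rewrite [RHS](reindex_inj (addIr (- u))).
by apply: eq_bigl => w; rewrite subr_eq0.
Qed.

(** The slopes of the secants at [x] together with [t x] exhaust [K], so their differences from
    [slope x y], apart from the zero one at [y], are the nonzero elements of [K], once each. *)
Let prod_slopes x y : x != y ->
  (\prod_(z | (z != y) && (z != x)) (slope x z - slope x y)) * (t x - slope x y)
    = \prod_(w : K | w != 0) w.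
Proof.
move=> xy; pose f z := if z == x then t x else slope x z.
have f_inj : injective f.
  move=> a b; rewrite /f; case: eqVneq => [->|ax]; case: eqVneq => [->|bx] //.
  - by move/esym/eqP; rewrite (negPf (slope_neq_tangent _)) // eq_sym.
  - by move/eqP; rewrite (negPf (slope_neq_tangent _)) // eq_sym.
  by apply: slope_inj; rewrite eq_sym.
rewrite -(prod_units (slope x y)) [RHS](reindex_inj f_inj).
have fy : slope x y = f y by rewrite /f eq_sym (negPf xy).
rewrite [in RHS](eq_bigl (fun z => z != y)); last first.
  by move=> z; rewrite /= fy (inj_eq f_inj).
rewrite [in RHS](bigD1 x) //= mulrC [f x]/f eqxx; congr (_ * _).
by apply: eq_bigr => z /andP[_ zx]; rewrite /f (negPf zx).
Qed.

Let prod_shift x y : x != y ->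
  (\prod_(z | (z != y) && (z != x)) (z - x)) * (y - x) = \prod_(w : K | w != 0) w.
Proof.
move=> xy; rewrite -(prod_units x) [RHS](bigD1 y) 1?eq_sym //= mulrC; congr (_ * _).
by apply: eq_bigl => z; rewrite andbC.
Qed.

Let prod_units_neq0 : \prod_(w : K | w != 0) w != 0.
Proof. by apply/prodf_neq0. Qed.

(** Segre's lemma of tangents. All the products involved equal the product of the nonzero elements,
    so dividing them out leaves only a sign, which makes [t x - slope x y] and [t y - slope x y]
    opposite. *)
Let tangent_sum x y : x != y -> t x + t y = 2 * slope x y.
Proof.
move=> xy; have yx : y != x by rewrite eq_sym.
have ex := prod_slopes xy; have ey := prod_slopes yx.
have sx := prod_shift xy; have sy := prod_shift yx.
rewrite (slopeC y x) in ey.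
have sw F : \prod_(z | (z != x) && (z != y)) F z
    = \prod_(z | (z != y) && (z != x)) F z :> K.
  by apply: eq_bigl => z; rewrite andbC.
rewrite sw in ey; rewrite sw in sy.
(* For each [z], both sides are the vertical distance at [z] from the graph to the secant through
   [x] and [y]. *)
have e : \prod_(z | (z != y) && (z != x)) (slope x z - slope x y) *
         \prod_(z | (z != y) && (z != x)) (z - x) =
         \prod_(z | (z != y) && (z != x)) (slope y z - slope x y) *
         \prod_(z | (z != y) && (z != x)) (z - y).
  rewrite -!big_split; apply: eq_bigr => z /andP[zy zx] /=.
  rewrite /slope; field.
  by rewrite !subr_eq0 zx zy yx.
move: ex ey sx sy e prod_units_neq0.
set W := \prod_(w | _) w; set P := fun z => (z != y) && (z != x).
set X := \prod_(z | P z) (slope x z - _); set Y := \prod_(z | P z) (slope y z - _).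
set U := \prod_(z | P z) (z - x); set Z := \prod_(z | P z) (z - y) => ex ey sx sy e W0.
have X0 : X != 0 by apply: contraNneq W0 => X0; rewrite -ex X0 mul0r.
have U0 : U != 0 by apply: contraNneq W0 => U0; rewrite -sx U0 mul0r.
have yx0 : y - x != 0 by rewrite subr_eq0.
have UZ : U = - Z.
  by apply: (mulIf yx0); rewrite sx -sy; ring.
have YX : Y = - X.
  by apply: (mulIf U0); rewrite mulNr e UZ; ring.
have: X * (t x + t y - 2 * slope x y) = 0.
  transitivity (X * (t x - slope x y) - Y * (t y - slope x y)); last first.
    by rewrite ex ey subrr.
  by rewrite YX; ring.
by move/eqP; rewrite mulf_eq0 (negPf X0) subr_eq0 => /eqP.
Qed.

(** Comparing [tangent_sum] on the pairs from 0, 1 and [x] shows that [t] is affine; the pair [x], 0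
    then expresses [h x] through [t x], as for a parabola. *)
Lemma function_arc_quadratic :
  exists a b c, a != 0 /\ forall x, h x = a * x ^+ 2 + b * x + c.
Proof.
pose a := (t 1 - t 0) / 2.
have te x : t x = 2 * a * x + t 0.
  have -> : 2 * a = t 1 - t 0 by rewrite /a; field.
  have [->|x0] := eqVneq x 0; first by ring.
  have [->|x1] := eqVneq x 1; first by ring.
  have e01 := tangent_sum (oner_neq0 K).
  have e0 := tangent_sum x0; have e1 := tangent_sum x1.
  (* With these weights the three doubled slopes become differences of values of [h], which
     cancel. *)
  have: x * (t x + t 0) - (x - 1) * (t x + t 1) - (t 1 + t 0) = 0.
    rewrite e0 e1 e01 /slope; field.
    by rewrite ?subr_eq0 ?oppr_eq0 ?x0 ?oner_eq0 /= eq_sym x1.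
  by move=> e; apply: subr0_eq; apply: etrans e; ring.
have he x : h x = a * x ^+ 2 + t 0 * x + h 0.
  have [->|x0] := eqVneq x 0; first by ring.
  have := tangent_sum x0; rewrite te /slope sub0r => e.
  apply: (mulfI two_neq0).
  have -> : 2 * h x = x * (2 * ((h 0 - h x) / - x)) * -1 * -1 + 2 * h 0.
    by field; rewrite oppr_eq0.
  by rewrite -e; ring.
exists a, (t 0), (h 0); split=> //.
(* If [a] vanished, the points over 0, 1 and -1 would be collinear. *)
apply: contraTneq isT => a0; have m10 : (-1 : K) != 0 by rewrite oppr_eq0 oner_eq0.
have m11 : (-1 : K) != 1 by rewrite eq_sym -subr_eq0 opprK.
have := noncollinear m10 m11; rewrite eq_sym oner_eq0 => /(_ isT) /negP[].
by rewrite !(he 1) !(he (-1)) a0; apply/eqP; ring.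
Qed.

End Segre.

Section QuadraticOnLines.
Variables (K : fieldType) (h : K -> K -> K) (k : K).
Hypotheses (two_neq0 : (2 : K) != 0) (k_neq0 : k != 0) (k_sqr : k ^+ 2 != 1).
Hypothesis quadratic_on_lines : forall x y u v, (u, v) != (0, 0) ->
  exists a b c, a != 0 /\
    forall l, h (x + l * u) (y + l * v) = a * l ^+ 2 + b * l + c.

Let quadratic_from_values (a b c : K) (g : K -> K) :
  (forall l, g l = a * l ^+ 2 + b * l + c) ->
  [/\ a = (g 1 + g (-1) - 2 * g 0) / 2, b = (g 1 - g (-1)) / 2 & c = g 0].
Proof. by move=> e; rewrite !e; split; field. Qed.

(** The polynomial vanishes at 0, 1, -1, k and -k. Its even part isolates [a], its odd part [b]; the
    conditions on [k] make the remaining factors nonzero. *)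
Let quartic_eq0 (a b c d e : K) :
  (forall l, a * l ^+ 4 + b * l ^+ 3 + c * l ^+ 2 + d * l + e = 0) -> a = 0 /\ b = 0.
Proof.
move=> g; have g0 := g 0; have g1 := g 1; have gm1 := g (-1).
have gk := g k; have gmk := g (- k).
have e0 : e = 0 by rewrite -[RHS]g0; ring.
have two_k : 2 * (k ^+ 2 * (k ^+ 2 - 1)) != 0.
  by rewrite !mulf_neq0 ?expf_neq0 // subr_eq0.
have two_k' : 2 * (k * (k ^+ 2 - 1)) != 0 by rewrite !mulf_neq0 // subr_eq0.
split; [apply: (mulfI two_k) | apply: (mulfI two_k')]; rewrite mulr0.
  transitivity ((a * k ^+ 4 + b * k ^+ 3 + c * k ^+ 2 + d * k + e) +
     (a * (-k) ^+ 4 + b * (-k) ^+ 3 + c * (-k) ^+ 2 + d * (-k) + e)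
     - k ^+ 2 * ((a * 1 ^+ 4 + b * 1 ^+ 3 + c * 1 ^+ 2 + d * 1 + e) +
     (a * (-1) ^+ 4 + b * (-1) ^+ 3 + c * (-1) ^+ 2 + d * (-1) + e))).
    by rewrite e0; ring.
  by rewrite gk gmk g1 gm1; ring.
transitivity ((a * k ^+ 4 + b * k ^+ 3 + c * k ^+ 2 + d * k + e) -
     (a * (-k) ^+ 4 + b * (-k) ^+ 3 + c * (-k) ^+ 2 + d * (-k) + e)
     - k * ((a * 1 ^+ 4 + b * 1 ^+ 3 + c * 1 ^+ 2 + d * 1 + e) -
     (a * (-1) ^+ 4 + b * (-1) ^+ 3 + c * (-1) ^+ 2 + d * (-1) + e))).
  by ring.
by rewrite gk gmk g1 gm1; ring.
Qed.

(** Horizontal and vertical lines bound the degree of [h] by 2 in each variable. On the diagonals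
    through the origin the terms of degree 4 and 3 must also vanish, which leaves total degree 2.
    The quadratic part at (u, v) is the leading coefficient in that direction. *)
Lemma quadratic_on_lines_conic :
  exists A B C D G H,
    (forall x y, h x y = A * x ^+ 2 + B * (x * y) + C * y ^+ 2 + D * x + G * y + H)
    /\ forall u v, (u, v) != (0, 0) ->
         A * u ^+ 2 + B * (u * v) + C * v ^+ 2 != 0.
Proof.
have ne10 : ((1, 0) : K * K) != (0, 0) by rewrite xpair_eqE oner_eq0.
have ne01 : ((0, 1) : K * K) != (0, 0) by rewrite xpair_eqE oner_eq0 andbF.
have horiz y : forall x, h x y = (h 1 y + h (-1) y - 2 * h 0 y) / 2 * x ^+ 2
                 + (h 1 y - h (-1) y) / 2 * x + h 0 y.
  have [a [b [c [_ e]]]] := quadratic_on_lines 0 y ne10.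
  have e' l : h l y = a * l ^+ 2 + b * l + c.
    by rewrite -e; congr h; ring.
  by have [<- <- <-] := quadratic_from_values e'.
have vert x : exists a b c, forall y, h x y = a * y ^+ 2 + b * y + c.
  have [a [b [c [_ e]]]] := quadratic_on_lines x 0 ne01.
  by exists a, b, c => l; rewrite -e; congr h; ring.
have [a0 [b0 [c0 h0]]] := vert 0; have [a1 [b1 [c1 h1]]] := vert 1.
have [a2 [b2 [c2 h2]]] := vert (-1).
(* Interpolation at 0, 1, -1: [P] gives the quadratic coefficient and [M] the linear one. *)
pose P p0 p1 p2 : K := (p1 + p2 - 2 * p0) / 2; pose M p1 p2 : K := (p1 - p2) / 2.
have hE x y : h x y = (P a0 a1 a2 * y ^+ 2 + P b0 b1 b2 * y + P c0 c1 c2) * x ^+ 2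
    + (M a1 a2 * y ^+ 2 + M b1 b2 * y + M c1 c2) * x + (a0 * y ^+ 2 + b0 * y + c0).
  by rewrite horiz h0 h1 h2 /P /M; field.
(* The coefficients of degree 4 and 3 of [h] along (l, m l). *)
have diag m : P a0 a1 a2 * m ^+ 2 = 0 /\ P b0 b1 b2 * m + M a1 a2 * m ^+ 2 = 0.
  have ne : ((1, m) : K * K) != (0, 0) by rewrite xpair_eqE oner_eq0.
  have [a [b [c [_ e]]]] := quadratic_on_lines 0 0 ne.
  apply: (@quartic_eq0 _ _ (P c0 c1 c2 + M b1 b2 * m + a0 * m ^+ 2 - a)
                      (M c1 c2 + b0 * m - b) (c0 - c)) => l.
  have := e l; rewrite !add0r mulr1 hE => el.
  by apply/eqP; rewrite -[X in _ == X](subrr (a * l ^+ 2 + b * l + c)) -{1}el; apply/eqP; ring.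
have [] := diag 1; rewrite expr1n !mulr1 => Pa0 e1.
have [] := diag (-1); rewrite sqrrN expr1n !mulr1 mulrN1 => _ e2.
have Ma0 : M a1 a2 = 0.
  apply: (mulfI two_neq0); rewrite mulr0 -[RHS](addr0 0) -{1}e1 -e2; ring.
have Pb0 : P b0 b1 b2 = 0 by move: e1; rewrite Ma0 addr0.
exists (P c0 c1 c2), (M b1 b2), a0, (M c1 c2), b0, c0; split=> [x y | u v uv].
  by rewrite hE Pa0 Ma0 Pb0; ring.
have [a [b [c [a_neq0 e]]]] := quadratic_on_lines 0 0 uv.
suff <- : a = P c0 c1 c2 * u ^+ 2 + M b1 b2 * (u * v) + a0 * v ^+ 2 by [].
have [-> _ _] := quadratic_from_values e.
by rewrite !hE Pa0 Ma0 Pb0; field.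
Qed.

End QuadraticOnLines.

(* The remaining three base points are (0, 0), (1, 0) and (0, 1); the hypotheses
   say which triples of the five are known not to be collinear. *)
Lemma conic_five_points (K : fieldType) (a b c d : K) :
  a != 0 -> c != 0 -> (a - 1) * d != b * (c - 1) ->
  exists A B, forall (h : K -> K -> K) A' B' C' D G H,
    (forall x y, h x y = A' * x ^+ 2 + B' * (x * y) + C' * y ^+ 2 + D * x + G * y + H) ->
    h 0 0 = 0 -> h 1 0 = 0 -> h 0 1 = 0 -> h a b = 0 -> h c d = 0 ->
    forall x y, h x y = C' * (A * (x ^+ 2 - x) + B * (x * y) + (y ^+ 2 - y)).
Proof.
move=> a0 c0 det; pose e := (a - 1) * d - b * (c - 1).
have e0 : e != 0 by rewrite subr_eq0.
pose m := a * c * e; have m0 : m != 0 by rewrite !mulf_neq0.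
(* Cramer's rule for the equations at (a, b) and (c, d), normalized by C' = 1; [m] is the
   determinant of the system. *)
exists ((a * b * (d ^+ 2 - d) - c * d * (b ^+ 2 - b)) / m),
 (((c ^+ 2 - c) * (b ^+ 2 - b) - (a ^+ 2 - a) * (d ^+ 2 - d)) / m).
move=> h A B C D G H hE h00 h10 h01 hab hcd x y.
have H0 : H = 0 by rewrite -h00 hE; ring.
have D0 : D = - A by apply: subr0_eq; rewrite -h10 hE H0; ring.
have G0 : G = - C by apply: subr0_eq; rewrite -h01 hE H0; ring.
move: hab hcd; rewrite !hE H0 D0 G0 => hab hcd.
apply: (mulfI m0); apply: subr0_eq.
transitivity ((x ^+ 2 - x) *
    (c * d * (A * a ^+ 2 + B * (a * b) + C * b ^+ 2 + - A * a + - C * b + 0)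
    - a * b * (A * c ^+ 2 + B * (c * d) + C * d ^+ 2 + - A * c + - C * d + 0))
  + x * y * ((a ^+ 2 - a) * (A * c ^+ 2 + B * (c * d) + C * d ^+ 2 + - A * c + - C * d + 0)
    - (c ^+ 2 - c) * (A * a ^+ 2 + B * (a * b) + C * b ^+ 2 + - A * a + - C * b + 0))).
  rewrite /m; rewrite /m in m0; rewrite /e; field; rewrite -/e.
  by rewrite a0 c0 e0.
by rewrite hab hcd; ring.
Qed.

(** * Affine planes of subspaces *)

Lemma card_bigcup_disjoint (I T : finType) (A : {set I}) (G : I -> {set T}) :
  (forall i j, i != j -> [disjoint G i & G j]) ->
  #|\bigcup_(i in A) G i| = (\sum_(i in A) #|G i|)%N.
Proof.
move=> dG; rewrite big_mkcond [RHS]big_mkcond -sum1_card /=.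
rewrite (partition_disjoint_bigcup addn (fun=> 1%N)) /=.
  by apply: eq_bigr => i _; case: ifP => _; rewrite ?sum1_card ?cards0.
move=> i j ij; case: ifP; case: ifP => _ _ //; rewrite ?dG // -setI_eq0 ?set0I ?setI0 //.
Qed.

Lemma card_vspace_set (F : finFieldType) (U : vectType F) (W : {vspace U}) :
  #|[set v : finvect_type U | v \in W]| = (#|F| ^ \dim W)%N.
Proof.
(* Only for a constructor are [{vspace U}] and [{vspace finvect_type U}] convertible. *)
case: U W => T c W; rewrite cardsE.
have := @card_vspace F _ (Vector.class (finvect_type (Vector.Pack c))) W.
by move=> <-; apply: eq_card.
Qed.

Lemma leq_card_bigcup (I T : finType) (A : {set I}) (G : I -> {set T}) :
  (#|\bigcup_(i in A) G i| <= \sum_(i in A) #|G i|)%N.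
Proof.
elim/big_rec2: _ => [|i m B _ le]; first by rewrite cards0.
by apply: leq_trans (leq_card_setU _ _) _; rewrite leq_add2l.
Qed.

Section AffinePlane.
Variables (F : finFieldType) (U : vectType F) (n : nat) (I : finType).
Variable P : I -> {vspace U}.
Let N := (#|F| ^ n)%N.
Hypotheses (F_gt2 : (2 < #|F|)%N) (n_gt0 : (0 < n)%N).
Hypotheses (dimU : \dim {:U} = (3 * n)%N) (dimP : forall i, \dim (P i) = n).
Hypothesis disjP : forall i j, i != j -> (P i :&: P j = 0)%VS.
Hypothesis cardI : #|I| = (N * N)%N.

Definition span_line i j : {set I} := [set k | (P k <= P i + P j)%VS].

Hypothesis card_line : forall i j, i != j -> #|span_line i j| = N.

Let vecs (W : {vspace U}) : {set finvect_type U} := [set v : finvect_type U | v \in W].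

Let card_vecs W : #|vecs W| = (#|F| ^ \dim W)%N.
Proof. exact: card_vspace_set. Qed.

Let vecs0 W : 0 \in vecs W. Proof. by rewrite inE; exact: mem0v. Qed.

Let N_gt2 : (2 < N)%N.
Proof.
rewrite /N -(prednK n_gt0) expnS (leq_trans F_gt2) // leq_pmulr // expn_gt0.
by rewrite (ltn_trans _ F_gt2).
Qed.

Let meetP i j v : v \in P i -> v \in P j -> v != 0 -> i = j.
Proof.
move=> vi vj; apply: contraNeq => ij.
by rewrite -memv0 -(disjP ij) memv_cap vi.
Qed.

Let dim_line i j : i != j -> \dim (P i + P j) = (n + n)%N.
Proof. by move=> ij; rewrite dimv_disjoint_sum ?disjP ?dimP. Qed.

Let mem_line i j k : (k \in span_line i j) = (P k <= P i + P j)%VS.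
Proof. by rewrite inE. Qed.

Let in_line1 i j : i \in span_line i j. Proof. by rewrite inE addvSl. Qed.

Let line_eq i j a b : i != j -> a != b -> a \in span_line i j -> b \in span_line i j ->
  (P a + P b = P i + P j)%VS.
Proof.
move=> ij ab; rewrite !mem_line => a_ij b_ij.
by apply/eqP; rewrite eqEdim subv_add a_ij b_ij !dim_line ?leqnn.
Qed.

(** With 0 added, this will turn out to be a subspace, the point at infinity of the line. *)
Let uncovered i j : {set finvect_type U} :=
  vecs (P i + P j)%VS :\: \bigcup_(k in span_line i j) vecs (P k).

Let uncoveredP i j (v : finvect_type U) : reflect
  ((v : U) \in P i + P j /\ forall k, k \in span_line i j -> (v : U) \notin P k)%VS
  (v \in uncovered i j).
Proof.
rewrite /uncovered in_setD in_set andbC; apply: (iffP andP) => -[v_ij nv]; split=> //.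
  move=> k kl; apply: contraNN nv => vk; apply/bigcupP; exists k => //.
  by rewrite inE.
by apply/bigcupP=> -[k /nv vk]; rewrite inE (negPf vk).
Qed.

(** The [N] members on the line meet pairwise in 0, so they cover 1 + N (N - 1) of its N^2
    vectors. *)
Let card_uncovered i j : i != j -> #|uncovered i j| = N.-1.
Proof.
move=> ij; pose nz k := vecs (P k) :\ 0.
have Ecov : \bigcup_(k in span_line i j) vecs (P k)
           = 0 |: \bigcup_(k in span_line i j) nz k.
  apply/setP=> v; rewrite !inE; apply/bigcupP/orP.
    case=> k kl vk; have [->|v0] := eqVneq v 0; [by left | right].
    by apply/bigcupP; exists k; rewrite // !inE v0 -[_ \in _](in_set) .
  case=> [/eqP-> | /bigcupP[k kl]]; first by exists i; rewrite ?in_line1 ?vecs0.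
  by rewrite inE => /andP[_ vk]; exists k.
have card_nz k : #|nz k| = N.-1.
  by have := cardsD1 0 (vecs (P k)); rewrite card_vecs dimP vecs0 /N => ->.
have Ecard : #|\bigcup_(k in span_line i j) nz k| = (N * N.-1)%N.
  have -> : (N * N.-1 = \sum_(k in span_line i j) #|nz k|)%N.
    by rewrite (eq_bigr (fun=> N.-1)) // sum_nat_const card_line.
  apply: card_bigcup_disjoint => a b ab; rewrite -setI_eq0 -subset0.
  apply/subsetP=> v; rewrite !inE => /andP[/andP[v0 va] /andP[_ vb]].
  by rewrite (meetP va vb v0) eqxx in ab.
have cov0 : 0 \notin \bigcup_(k in span_line i j) nz k.
  by apply/bigcupP=> -[k _]; rewrite !inE eqxx.
rewrite cardsD (setIidPr _).
  rewrite Ecov cardsU1 cov0 Ecard card_vecs dim_line // expnD -/N; nia.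
apply/bigcupsP=> k; rewrite mem_line => /subvP kl.
by apply/subsetP=> v; rewrite !inE; apply: kl.
Qed.

(* Two lines through [i] cannot share more than [P i]: a further common vector is
   uncovered on one of them, and 2 (N - 1) uncovered vectors are too few. *)
Let line_meet i j k : i != j -> k \notin span_line i j ->
  ((P i + P j) :&: (P i + P k) = P i)%VS.
Proof.
move=> ij kl; have ik : i != k by apply: contraNneq kl => <-; exact: in_line1.
set W := ((P i + P j) :&: (P i + P k))%VS.
have PW : (P i <= W)%VS by rewrite subv_cap !addvSl.
apply/eqP; rewrite eq_sym eqEdim PW dimP /=.
have sub : vecs W :\: vecs (P i) \subset uncovered i j :|: uncovered i k.
  apply/subsetP=> v /setDP[]; rewrite in_setU ![_ \in vecs _]in_set => /memv_capP[v_j v_k] v_i.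
  apply/orP; have [|/uncoveredP nv] := boolP (v \in uncovered i j); first by left.
  right; apply/uncoveredP; split=> // b bl; apply/negP=> vb.
  apply: nv; split=> // a al; apply/negP=> va.
  have v0 : v != 0 by apply: contraNneq v_i => ->; exact: mem0v.
  have eab := meetP va vb v0; rewrite -eab in bl.
  have ai : i != a by apply: contraNneq v_i => ->.
  case/negP: kl; rewrite mem_line -(line_eq ij ai) ?in_line1 //.
  by rewrite (line_eq ik ai) ?in_line1 // addvSr.
have := leq_trans (subset_leq_card sub) (leq_card_setU _ _).
rewrite !card_uncovered // cardsD (setIidPr _); last first.
  by apply/subsetP=> v; rewrite !inE; apply/subvP.
rewrite !card_vecs dimP -/N; apply: contraTT; rewrite -!ltnNge => lt.
have : (#|F| ^ n.+1 <= #|F| ^ \dim W)%N by rewrite leq_exp2l // (ltn_trans _ F_gt2).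
rewrite expnS -/N; move: N_gt2 F_gt2; nia.
Qed.

Lemma affine_span i j k : i != j -> k \notin span_line i j ->
  (P i + P j + P k)%VS = fullv.
Proof.
move=> ij kl; have ik : i != k by apply: contraNneq kl => <-; exact: in_line1.
apply/eqP; rewrite eqEdim subvf dimU /=.
have -> : (P i + P j + P k = (P i + P j) + (P i + P k))%VS.
  by rewrite addvA (addvC _ (P i)) addvA addvv.
have := dimv_sum_cap (P i + P j) (P i + P k).
by rewrite line_meet // !dim_line // dimP; lia.
Qed.

Let meet_off_line i j k : i != j -> k \notin span_line i j -> (P k :&: (P i + P j) = 0)%VS.
Proof.
move=> ij kl; have ik : i != k by apply: contraNneq kl => <-; exact: in_line1.
apply/eqP; rewrite -subv0 -(disjP ik) subv_cap capvSl andbT.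
by rewrite -[X in (_ <= X)%VS](line_meet ij kl) capvC capvS // addvSr.
Qed.

Let off_line_eq0 i j k (v : U) : i != j -> k \notin span_line i j ->
  v \in P k -> v \in (P i + P j)%VS -> v = 0.
Proof.
move=> ij kl vk vij; apply/eqP.
by rewrite -memv0 -(meet_off_line ij kl) memv_cap vk.
Qed.

(** The [N] lines joining [k] to the points of the line [i j] contain at most 1 + N (N - 1) of the
    N^2 points; any other point can serve as [m]. *)
Let parallel i j k : i != j -> k \notin span_line i j ->
  exists2 m, m != k & [disjoint span_line k m & span_line i j].
Proof.
move=> ij kl; set B := \bigcup_(x in span_line i j) (span_line k x :\ k).
have leB : (#|B| <= N * N.-1)%N.
  apply: leq_trans (leq_card_bigcup _ _) _.
  rewrite (eq_bigr (fun=> N.-1)) ?sum_nat_const ?card_line // => x xl.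
  have kx : k != x by apply: contraNneq kl => ->.
  by have := cardsD1 k (span_line k x); rewrite card_line // in_line1 => ->.
have /set0Pn[m] : ~: (k |: B) != set0.
  rewrite -card_gt0 cardsCs setCK subn_gt0 cardI.
  apply: leq_ltn_trans (leq_card_setU _ _) _; rewrite cards1.
  apply: leq_ltn_trans (leq_add (leqnn 1) leB) _; move: N_gt2; nia.
rewrite inE in_setU1 negb_or => /andP[mk mB]; exists m => //.
rewrite disjoint_subset; apply/subsetP=> x xkm; apply: contraNN mB => xl.
have kx : k != x by apply: contraNneq kl => ->.
apply/bigcupP; exists x => //; rewrite in_setD1 mk mem_line.
by rewrite (@line_eq k m k x) ?in_line1 ?addvSr // eq_sym.
Qed.

(** A nonzero common vector lies in no [P a] with [a] on [i j], since such an [a] is off the line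
    [k m]; so there are at most N - 1 of them. Two subspaces of dimension 2n in dimension 3n meet in
    dimension at least n, which forces equality. *)
Let parallel_meet i j k m : i != j -> k != m ->
    [disjoint span_line k m & span_line i j] ->
  \dim ((P i + P j) :&: (P k + P m)) = n /\
  forall v : finvect_type U, ((v : U) \in ((P i + P j) :&: (P k + P m))%VS) =
    ((v : U) == 0) || (v \in uncovered i j).
Proof.
move=> ij km dl; set W := (_ :&: _)%VS.
have sub : vecs W :\ 0 \subset uncovered i j.
  apply/subsetP=> v /setD1P[v0]; rewrite in_set => /memv_capP[v_ij v_km].
  apply/uncoveredP; split=> // a al; apply/negP=> va; case/negP: v0.
  have akm : a \notin span_line k m by rewrite (disjointFl dl).
  by apply/eqP; exact: (off_line_eq0 km akm).
have leW := subset_leq_card sub; rewrite card_uncovered // in leW.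
have cardW := cardsD1 0 (vecs W); rewrite card_vecs vecs0 in cardW.
have dimW : \dim W = n.
  apply/eqP; rewrite eqn_leq -(@leq_exp2l #|F|) ?(ltn_trans _ F_gt2) // cardW.
  apply/andP; split.
    by rewrite add1n -/N -[in leqRHS](ltn_predK N_gt2) ltnS.
  have := dimv_sum_cap (P i + P j) (P k + P m); rewrite -/W !dim_line //.
  have := dimvS (subvf (P i + P j + (P k + P m))); rewrite dimU; lia.
split=> // v.
have /eqP eW : vecs W :\ 0 == uncovered i j.
  by rewrite eqEcard sub card_uncovered //; rewrite dimW in cardW; rewrite /N cardW add1n leqnn.
rewrite -eW in_setD1 in_set; case: eqVneq => //= ->; exact: mem0v.
Qed.

Let uncovered_free i j (v : U) : i != j -> v \in uncovered i j -> forall k, v \notin P k.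
Proof.
move=> ij /uncoveredP[v_ij nv] k; have [/nv //|kl] := boolP (k \in span_line i j).
apply/negP=> vk; have := mem0v (P i); rewrite -(off_line_eq0 ij kl vk v_ij).
 apply/negP/nv/in_line1.
Qed.

(* [R] is the point at infinity of the line [i j]. *)
Lemma line_direction i j l : i != j -> l \notin span_line i j ->
  exists R : {vspace U}, [/\ \dim R = n, (R <= P i + P j)%VS,
    forall k, (P k :&: R = 0)%VS
    & forall k, exists2 a, a \in span_line i l & (P k <= P a + R)%VS].
Proof.
move=> ij lij; have il : i != l by apply: contraNneq lij => <-; exact: in_line1.
have [m ml dl] := parallel ij lij; rewrite eq_sym in ml.
have [dimR memR] := parallel_meet ij ml dl.
set R := (_ :&: _)%VS in dimR memR; have R_ij : (R <= P i + P j)%VS by exact: capvSl.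
have freeR k : (P k :&: R = 0)%VS.
  apply/eqP; rewrite -subv0; apply/subvP=> v /memv_capP[vk]; rewrite memR memv0.
  by case/orP=> // /(uncovered_free ij)/(_ k)/negP.
(* Off the line [i j], take a parallel to [i j] through [k]: it meets [P i + P j] in the same
   uncovered set, hence contains [R]. *)
have line_through k : exists2 b, k != b & (P k + R = P k + P b)%VS.
  have dim_kR : \dim (P k + R) = (n + n)%N by rewrite dimv_disjoint_sum // dimP dimR.
  have full b : k != b -> (R <= P k + P b)%VS -> (P k + R = P k + P b)%VS.
    by move=> kb Rkb; apply/eqP; rewrite eqEdim subv_add addvSl Rkb dim_kR dim_line // leqnn.
  have [kij|kij] := boolP (k \in span_line i j).
    have [ki|ki] := eqVneq k i.
      by exists j; [rewrite ki | apply: full; rewrite ki].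
    by exists i => //; apply: full => //; rewrite (line_eq ij ki) ?in_line1.
  have [b bk db] := parallel ij kij; rewrite eq_sym in bk; exists b => //; apply: full => //.
  have [_ memR'] := parallel_meet ij bk db.
  by apply/subvP=> v; rewrite memR -memR' => /memv_capP[].
exists R; split=> // k; have [b kb eR] := line_through k.
have [/pred0P dkb|/pred0Pn[a /andP[/= akb ail]]] := boolP [disjoint span_line k b & span_line i l].
  (* If the line [k b] also missed [i l], then [R] would lie in [P i + P l] as well as in
     [P i + P j], hence in [P i], which it avoids. *)
  have {}dkb : [disjoint span_line k b & span_line i l] by apply/pred0P.
  have [_ mem1] := parallel_meet il kb dkb.
  rewrite disjoint_sym in dkb; have [_ mem2] := parallel_meet kb il dkb.
  have : (R <= P i :&: R)%VS.
    rewrite -{1}(line_meet ij lij) -capvA subv_cap R_ij subv_cap subvv andbT.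
    apply/subvP=> v vR; suff: v \in ((P k + P b) :&: (P i + P l))%VS by case/memv_capP.
    rewrite mem2; have [//|v0] := eqVneq v 0; apply/uncoveredP; split.
      by rewrite -eR; apply: (subvP (addvSr _ _)).
    move=> c _; move: vR; rewrite memR (negPf v0) /= => vu; exact: (uncovered_free ij vu).
  by rewrite freeR subv0 -dimv_eq0 dimR; move: n_gt0; lia.
exists a => //; have [->|ak] := eqVneq a k; first exact: addvSl.
suff -> : (P a + R = P k + R)%VS by exact: addvSl.
apply/eqP; rewrite eqEdim !dimv_disjoint_sum // !dimP leqnn andbT subv_add addvSr.
by rewrite eR -mem_line akb.
Qed.

Lemma affine_notin i j l : i != j -> l \notin span_line i j -> j \notin span_line i l.
Proof.
move=> ij lij; apply/negP; rewrite mem_line => jl.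
have il : i != l by apply: contraNneq lij => <-; exact: in_line1.
have : (fullv <= P i + P l)%VS by rewrite -(affine_span ij lij) !subv_add jl addvSl addvSr.
by move/dimvS; rewrite dimU dim_line //; move: n_gt0; lia.
Qed.

(** [R] and [S] are the points at infinity of the axes [i j] and [i l], and [R + S] is the line at
    infinity. The last clause projects each point to the axes, along [R] and along [S]. *)
Lemma affine_frame i j l : i != j -> l \notin span_line i j ->
  exists R S : {vspace U},
  [/\ [/\ \dim R = n, \dim S = n & (R :&: S = 0)%VS],
      (R <= P i + P j)%VS, (S <= P i + P l)%VS, forall k, (P k :&: (R + S) = 0)%VS
    & forall k, (exists2 a, a \in span_line i l & (P k <= P a + R)%VS) /\
                (exists2 a, a \in span_line i j & (P k <= P a + S)%VS)].
Proof.
move=> ij lij; have il : i != l by apply: contraNneq lij => <-; exact: in_line1.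
have jil := affine_notin ij lij.
have [R [dimR R_ij freeR projR]] := line_direction ij lij.
have [S [dimS S_il freeS projS]] := line_direction il jil.
have capR : ((P i + P l) :&: R = 0)%VS.
  apply/eqP; rewrite -subv0 -(freeR i) subv_cap capvSr andbT.
  by rewrite -[X in (_ <= X)%VS](line_meet ij lij) capvC capvS.
exists R, S; split=> // [|k].
  split=> //; apply/eqP; rewrite -subv0 -capR subv_cap capvSl andbT.
  by apply: subv_trans (capvSr _ _) S_il.
(* A vector of [P k] at infinity is r + s, and by projection also p + r' with p in [P a]. Comparing
   modulo [R] gives p = s, which is 0 because [S] avoids [P a]; then the vector lies in [R], which
   avoids [P k]. *)
have [a ail /subvP kaR] := projR k.
apply/eqP; rewrite -subv0; apply/subvP=> v /memv_capP[vk /memv_addP[r rR [s sS ev]]].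
have /memv_addP[p pa [r' r'R ev']] := kaR v vk.
have rr' : r - r' = 0.
  apply/eqP; rewrite -memv0 -capR memv_cap [X in _ && X]rpredB // andbT.
  have -> : r - r' = p - s by apply/eqP; rewrite subr_eq addrAC eq_sym subr_eq -ev -ev'.
  rewrite rpredB //; first by apply: (subvP _ _ pa); rewrite -mem_line.
  exact: (subvP S_il).
have ps : p = s.
  by apply: (addIr r'); rewrite -ev' ev addrC; congr (_ + _); exact: subr0_eq.
have p0 : p = 0 by apply/eqP; rewrite -memv0 -(freeS a) memv_cap pa ps sS.
by rewrite -(freeR k) memv_cap vk ev' p0 add0r r'R.
Qed.

End AffinePlane.

(** * Matrix coordinates *)

Lemma injective_capker (K : fieldType) (U V : vectType K) (f : 'Hom(U, V)) (W : {vspace U}) :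
  injective f -> (W :&: lker f = 0)%VS.
Proof. by move/lker0P/eqP=> ->; rewrite capv0. Qed.

Lemma subspace_parametrization (K : fieldType) (U : vectType K) (W : {vspace U}) (n : nat) :
  \dim W = n -> exists2 f : 'Hom('rV[K]_n, U), injective f & limg f = W.
Proof.
move=> <-; pose g := linfun (vsval \o @r2v _ (subvs_of W)).
have g_inj : injective g by move=> x y; rewrite !lfunE /= => /val_inj/(can_inj r2vK).
have gW x : g x \in W by rewrite lfunE subvsP.
exists g => //; apply/eqP.
rewrite eqEdim limg_dim_eq ?injective_capker // dimvf.
apply/andP; split; last exact: eq_leq (esym (mul1n _)).
by apply/subvP=> _ /memv_imgP[x _ ->]; exact: gW.
Qed.

Lemma partial_inverse (K : fieldType) (U V : vectType K) (f : 'Hom(U, V)) (W : {vspace U}) :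
  (W :&: lker f = 0)%VS ->
  exists g : 'Hom(V, U), (forall v, g v \in W) /\ {in W, cancel f g}.
Proof.
move=> cap0; pose h := (f \o projv W)%VF; exists (projv W \o h^-1)%VF.
split=> [v | u uW]; first by rewrite comp_lfunE memv_proj.
rewrite comp_lfunE; set w := projv W _.
have wW : w \in W by exact: memv_proj.
apply/eqP; rewrite -subr_eq0 -memv0 -cap0 memv_cap rpredB //= memv_ker linearB /= subr_eq0.
have fu : f u = h u by rewrite comp_lfunE projv_id.
rewrite /w -[f (projv _ _)](comp_lfunE f) -/h limg_lfunVK ?fu //.
by rewrite memv_img ?memvf.
Qed.

Lemma dim_rowspace (K : fieldType) n : \dim {:'rV[K]_n} = n.
Proof. by rewrite dimvf /dim /= mul1n. Qed.

Lemma three_coordinates (K : fieldType) (X U : vectType K) (f0 f1 f2 : 'Hom(X, U)) :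
    \dim {:U} = (3 * \dim {:X})%N ->
    (forall x y z, f0 x + f1 y + f2 z = 0 -> [/\ x = 0, y = 0 & z = 0]) ->
  exists k0 k1 k2 : 'Hom(U, X),
    (forall u, u = f0 (k0 u) + f1 (k1 u) + f2 (k2 u)) /\
    (forall x y z, let u := f0 x + f1 y + f2 z in [/\ k0 u = x, k1 u = y & k2 u = z]).
Proof.
move=> dimU inj; pose T := (X * X * X)%type.
pose f : 'Hom(T, U) := ((f0 \o (linfun fst \o linfun fst)) +
    (f1 \o (linfun snd \o linfun fst)) + (f2 \o linfun snd))%VF.
have fE (t : T) : f t = f0 t.1.1 + f1 t.1.2 + f2 t.2.
  by rewrite !add_lfunE !comp_lfunE !lfunE.
have f_inj : lker f = 0%VS.
  apply/eqP; rewrite -subv0; apply/subvP=> -[[x y] z]; rewrite memv_ker fE memv0.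
  by move=> /eqP/inj[/= -> -> ->].
have f_surj : limg f = fullv.
  apply/eqP; rewrite eqEdim subvf limg_dim_eq ?f_inj ?capv0 //.
  have : \dim {:T} = (\dim {:X} + \dim {:X} + \dim {:X})%N by rewrite !dimvf.
  by rewrite dimU => ->; lia.
have fK : cancel f (f^-1)%VF by apply: lker0_lfunK; rewrite f_inj.
have Kf u : f ((f^-1)%VF u) = u by apply: limg_lfunVK; rewrite f_surj memvf.
exists ((linfun fst \o linfun fst) \o f^-1)%VF, ((linfun snd \o linfun fst) \o f^-1)%VF,
  (linfun snd \o f^-1)%VF.
split=> [u | x y z u].
  by rewrite !comp_lfunE !lfunE -fE Kf.
by rewrite /u -(fE (x, y, z)) !comp_lfunE fK !lfunE.
Qed.

Lemma mulmx_rV_inj (K : fieldType) (m n : nat) (A B : 'M[K]_(m, n)) :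
  (forall x : 'rV_m, x *m A = x *m B) -> A = B.
Proof. by move=> e; apply/row_matrixP=> i; rewrite !rowE e. Qed.

Lemma rV_neq0_exists (K : fieldType) (n : nat) : (0 < n)%N -> exists x : 'rV[K]_n, x != 0.
Proof.
case: n => // n _; exists (const_mx 1).
by apply/eqP=> /rowP/(_ ord0); rewrite !mxE => /eqP; rewrite oner_eq0.
Qed.

Section AffineCoordinates.
Variables (F : finFieldType) (U : vectType F) (n : nat) (I : finType).
Variable P : I -> {vspace U}.
Let N := (#|F| ^ n)%N.
Hypotheses (F_gt2 : (2 < #|F|)%N) (n_gt0 : (0 < n)%N).
Hypotheses (dimU : \dim {:U} = (3 * n)%N) (dimP : forall i, \dim (P i) = n).
Hypothesis disjP : forall i j, i != j -> (P i :&: P j = 0)%VS.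
Hypothesis cardI : #|I| = (N * N)%N.
Hypothesis card_line : forall i j, i != j -> #|span_line P i j| = N.

Let X := 'rV[F]_n.

(** The space is the sum of [P i], [R] and [S]. As [P k] misses [R + S], it is a graph over the
    first summand, given by two matrices; the identifications of [R] and [S] with the rows are
    chosen to give [P j] and [P l] identity matrices. *)
Lemma affine_coordinates i j l : i != j -> l \notin span_line P i j ->
  exists (f0 f1 f2 : 'Hom(X, U)) (A B : I -> 'M[F]_n),
  [/\ forall x y z, f0 x + f1 y + f2 z = 0 -> [/\ x = 0, y = 0 & z = 0],
      forall u, exists x y z, u = f0 x + f1 y + f2 z,
      forall k x y z, (f0 x + f1 y + f2 z \in P k) = (y == x *m A k) && (z == x *m B k),
      [/\ A i = 0 /\ B i = 0, A j = 1%:M /\ B j = 0 & A l = 0 /\ B l = 1%:M]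
    & forall k, (exists a, A a = 0 /\ B a = B k) /\ (exists a, A a = A k /\ B a = 0)].
Proof.
move=> ij lij; have il : i != l by apply: contraNneq lij => <-; rewrite inE addvSl.
have [R [S [[dimR dimS capRS] R_ij S_il freeRS proj]]] :=
  affine_frame F_gt2 n_gt0 dimU dimP disjP cardI card_line ij lij.
have capP k (W : {vspace U}) : (W <= R + S)%VS -> (P k :&: W = 0)%VS.
  by move=> WRS; apply/eqP; rewrite -subv0 -(freeRS k) capvS.
have freeR k := capP k R (addvSl R S); have freeS k := capP k S (addvSr R S).
have [f0 f0_inj imf0] := subspace_parametrization (dimP i).
have f0P x : f0 x \in P i by rewrite -imf0 memv_img ?memvf.
(* Split [f0 x] along [W] and [P j']; minus its component in [W] is the correction that moves [f0 x]
   into [P j']. *)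
have companion j' W : i != j' -> \dim W = n -> (P j' :&: W = 0)%VS -> (W <= P i + P j')%VS ->
    exists f : 'Hom(X, U), [/\ injective f, forall x, f x \in W & forall x, f0 x + f x \in P j'].
  move=> ij' dimW capW W_ij; have capW' : (W :&: P j' = 0)%VS by rewrite capvC.
  exists (- (daddv_pi W (P j') \o f0))%VF.
  have fW x : (- (daddv_pi W (P j') \o f0))%VF x = - daddv_pi W (P j') (f0 x).
    by rewrite opp_lfunE comp_lfunE.
  have PW x : f0 x - daddv_pi W (P j') (f0 x) \in P j'.
    have f0x : f0 x \in (W + P j')%VS.
      suff <- : (P i + P j' = W + P j')%VS by exact: (subvP (addvSl _ _)).
      apply/eqP; rewrite eq_sym eqEdim subv_add W_ij addvSr.
      by rewrite !dimv_disjoint_sum ?disjP // !dimP dimW leqnn.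
    by rewrite -{1}(daddv_pi_add capW' f0x) addrC addKr memv_pi.
  split=> [x y | x | x]; rewrite !fW ?rpredN ?memv_pi //.
  move=> /oppr_inj e; apply: f0_inj; apply/eqP; rewrite -subr_eq0 -memv0 -(disjP ij').
  rewrite memv_cap rpredB //=.
  have -> : f0 x - f0 y = (f0 x - daddv_pi W (P j') (f0 x)) - (f0 y - daddv_pi W (P j') (f0 y)).
    by rewrite e opprB addrA subrK.
  by rewrite rpredB.
have [f1 [f1_inj f1R f1P]] := companion j R ij dimR (freeR j) R_ij.
have [f2 [f2_inj f2S f2P]] := companion l S il dimS (freeS l) S_il.
have fRS y z : f1 y + f2 z \in (R + S)%VS by rewrite memv_add.
have eq0 x y z : f0 x + f1 y + f2 z = 0 -> [/\ x = 0, y = 0 & z = 0].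
  move=> e; have x0 : x = 0.
    apply: f0_inj; rewrite linear0; apply/eqP; rewrite -memv0 -(freeRS i) memv_cap f0P /=.
    have -> : f0 x = - (f1 y + f2 z) by apply/eqP; rewrite -addr_eq0 addrA e.
    by rewrite rpredN.
  move: e; rewrite x0 linear0 add0r => e; have ey : f1 y = - f2 z by apply/eqP; rewrite -addr_eq0 e.
  have y0 : y = 0.
    apply: f1_inj; rewrite linear0; apply/eqP; rewrite -memv0 -capRS memv_cap f1R /=.
    by rewrite ey rpredN.
  split=> //; apply: f2_inj; rewrite linear0; apply: oppr_inj.
  by rewrite -ey y0 linear0 oppr0.
have [k0 [k1 [k2 [fk kf]]]] : exists k0 k1 k2 : 'Hom(U, X),
    (forall u, u = f0 (k0 u) + f1 (k1 u) + f2 (k2 u)) /\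
    (forall x y z, let u := f0 x + f1 y + f2 z in [/\ k0 u = x, k1 u = y & k2 u = z]).
  by apply: three_coordinates => //; rewrite dim_rowspace.
have /fin_all_exists[AB memAB] : forall k, exists AB : 'M[F]_n * 'M[F]_n, forall x y z,
    (f0 x + f1 y + f2 z \in P k) = (y == x *m AB.1) && (z == x *m AB.2).
  move=> k.
  have capk : (P k :&: lker k0 = 0)%VS.
    apply/eqP; rewrite -subv0; apply/subvP=> u /memv_capP[uk]; rewrite memv_ker => /eqP u0.
    by rewrite -(freeRS k) memv_cap uk (fk u) u0 linear0 add0r fRS.
  have [g [gP gK]] := partial_inverse capk.
  have k0g x : k0 (g x) = x.
    have : x \in (k0 @: P k)%VS.
      suff -> : (k0 @: P k = fullv)%VS by exact: memvf.
      by apply/eqP; rewrite eqEdim subvf limg_dim_eq ?capk // dimP dim_rowspace leqnn.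
    by case/memv_imgP=> u uk ->; rewrite gK.
  exists (lin1_mx (k1 \o g)%VF, lin1_mx (k2 \o g)%VF) => x y z /=.
  rewrite !mul_rV_lin1 /= !comp_lfunE.
  have [e0 e1 e2] := kf x y z; set u := _ + _ + _ in e0 e1 e2 *.
  apply/idP/andP=> [uP | [/eqP ey /eqP ez]].
    by rewrite -e0 gK // e1 e2.
  suff -> : u = g x by exact: gP.
  by rewrite /u [RHS]fk k0g ey ez.
pose A k := (AB k).1; pose B k := (AB k).2.
have memP k x y z : (f0 x + f1 y + f2 z \in P k) = (y == x *m A k) && (z == x *m B k).
  exact: memAB.
have surj u : exists x y z, u = f0 x + f1 y + f2 z by exists (k0 u), (k1 u), (k2 u).
have AB_eq k A' B' : (forall x, f0 x + f1 (x *m A') + f2 (x *m B') \in P k) ->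
    A k = A' /\ B k = B'.
  move=> h; split; apply: mulmx_rV_inj => x; have := h x; rewrite memP.
    by case/andP=> /eqP.
  by case/andP=> _ /eqP.
have memk c x : f0 x + f1 (x *m A c) + f2 (x *m B c) \in P c by rewrite memP !eqxx.
have Ai : A i = 0 /\ B i = 0.
  by apply: AB_eq => x; rewrite !mulmx0 !linear0 !addr0.
have Aj : A j = 1%:M /\ B j = 0.
  by apply: AB_eq => x; rewrite mulmx0 mulmx1 linear0 addr0.
have Al : A l = 0 /\ B l = 1%:M.
  by apply: AB_eq => x; rewrite mulmx0 mulmx1 linear0 addr0.
have f_eq x y z x' y' z' : f0 x + f1 y + f2 z = f0 x' + f1 y' + f2 z' ->
    [/\ x = x', y = y' & z = z'].
  move=> e; have [e0 e1 e2] := kf x y z; have [e0' e1' e2'] := kf x' y' z'.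
  rewrite e in e0 e1 e2; split.
  - exact: etrans (esym e0) e0'.
  - exact: etrans (esym e1) e1'.
  exact: etrans (esym e2) e2'.
have surjR r : r \in R -> exists y, r = f1 y.
  have dimf1 : (limg f1 = R)%VS.
    apply/eqP; rewrite eqEdim limg_dim_eq ?injective_capker // dim_rowspace dimR leqnn andbT.
    by apply/subvP=> _ /memv_imgP[y _ ->].
  by rewrite -dimf1 => /memv_imgP[y _ ->]; exists y.
have surjS r : r \in S -> exists y, r = f2 y.
  have dimf2 : (limg f2 = S)%VS.
    apply/eqP; rewrite eqEdim limg_dim_eq ?injective_capker // dim_rowspace dimS leqnn andbT.
    by apply/subvP=> _ /memv_imgP[y _ ->].
  by rewrite -dimf2 => /memv_imgP[y _ ->]; exists y.
have surjPi v : v \in P i -> exists x, v = f0 x.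
  by rewrite -imf0 => /memv_imgP[x _ ->]; exists x.
exists f0, f1, f2, A, B; split=> // k; have [[a ail Pka] [b bij Pkb]] := proj k.
split; [exists a | exists b]; apply: AB_eq => x.
  (* Vectors of [P i + P l] have second coordinate 0, so removing the [R] part of the vector of
     [P k] over [x] leaves (x, 0, x B k) in [P a]. *)
  have /memv_addP[p pa [r /surjR[y ->] e]] := subvP Pka _ (memk k x).
  have ep : p = f0 x + f1 (x *m A k - y) + f2 (x *m B k).
    by apply: (addIr (f1 y)); rewrite -e linearB /= [RHS]addrAC -[in RHS](addrA (f0 x)) subrK.
  have : p \in (P i + P l)%VS by apply: (subvP _ _ pa); rewrite inE in ail.
  case/memv_addP=> _ /surjPi[x1 ->] [p2]; have [x2 [y2 [z2 ->]]] := surj p2.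
  rewrite (memP l) Al.1 Al.2 mulmx0 mulmx1 => /andP[/eqP-> /eqP->] e'.
  have : f0 x + f1 (x *m A k - y) + f2 (x *m B k) = f0 (x1 + x2) + f1 0 + f2 x2.
    by rewrite -ep e' !linear0 !addr0 linearD /= addrA.
  by case/f_eq => _ ey _; rewrite mulmx0 -ey -ep.
have /memv_addP[p pa [r /surjS[y ->] e]] := subvP Pkb _ (memk k x).
have ep : p = f0 x + f1 (x *m A k) + f2 (x *m B k - y).
  by rewrite linearB /= addrA e addrK.
have : p \in (P i + P j)%VS by apply: (subvP _ _ pa); rewrite inE in bij.
case/memv_addP=> _ /surjPi[x1 ->] [p2]; have [x2 [y2 [z2 ->]]] := surj p2.
rewrite (memP j) Aj.1 Aj.2 mulmx0 mulmx1 => /andP[/eqP-> /eqP->] e'.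
have : f0 x + f1 (x *m A k) + f2 (x *m B k - y) = f0 (x1 + x2) + f1 x2 + f2 0.
  by rewrite -ep e' !linear0 !addr0 linearD /= addrA.
by case/f_eq => _ _ ey; rewrite mulmx0 -ey -ep.
Qed.

End AffineCoordinates.

(** * Spread sets and Desarguesian planes *)

Section FiniteDivisionSubring.
Variables (R : finUnitRingType) (A : {pred R}).
Hypothesis A_divring : divring_closed A.
Hypothesis A_unit : {in A, forall x, x != 0 -> x \is a GRing.unit}.

Let S : {pred R} := A.
HB.instance Definition _ := GRing.isDivringClosed.Build R S A_divring.
Let T := {x : R | x \in S}.
HB.instance Definition _ := SubType.on T.
HB.instance Definition _ := Finite.on T.
HB.instance Definition _ := [SubChoice_isSubUnitRing of T by <:].

(** Wedderburn's little theorem, for [A] packaged as a finite domain. *)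
Lemma finite_division_subring_comm : {in A &, commutative *%R}.
Proof.
have domT : GRing.integral_domain_axiom T.
  move=> x y /(congr1 val)/eqP; rewrite -!val_eqE /=.
  have [//|x0] := eqVneq (val x) 0; rewrite mulrI_eq0 //.
  by apply/mulrI/A_unit/x0/valP.
move=> x y xA yA.
exact: (congr1 val (finDomain_mulrC domT (Sub x xA) (Sub y yA))).
Qed.

End FiniteDivisionSubring.

Section FieldSubalgebra.
Variables (F : fieldType) (aT : falgType F) (B : {aspace aT}).
Hypotheses (B1 : 1 \in B) (B_comm : {in B &, commutative *%R}).
Hypothesis B_unit : {in B, forall u, u != 0 -> u \is a GRing.unit}.

Let L := subvs_of B.
HB.instance Definition _ := Falgebra.on L.
HB.instance Definition _ := SubType.on L.

Let vsval1 : vsval (1 : L) = 1. Proof. by apply/eqP; rewrite /= algid_eq1. Qed.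

Let L_comm : commutative (@GRing.mul L).
Proof. by move=> x y; apply: val_inj; exact: B_comm (valP x) (valP y). Qed.

HB.instance Definition _ := GRing.PzRing_hasCommutativeMul.Build L L_comm.

Let L_field : GRing.field_axiom L.
Proof.
by move=> x x0; apply/vsval_unitr/B_unit/x0/valP.
Qed.

Let L_domain : GRing.integral_domain_axiom L.
Proof.
move=> x y xy0; case: eqVneq => //= /L_field xU.
by rewrite -(mulrI_eq0 _ (mulrI xU)) xy0.
Qed.

HB.instance Definition _ := GRing.ComUnitRing_isIntegral.Build L L_domain.
HB.instance Definition _ := GRing.UnitRing_isField.Build L L_field.

Lemma field_of_subalgebra : exists (K : fieldExtType F) (r : 'Hom(K, aT)),
  [/\ \dim {:K} = \dim B, injective r, limg r = B, r 1 = 1 & {morph r : x y / x * y}].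
Proof.
exists (L : fieldExtType F), (linfun (vsval : L -> aT)); split=> [|x y||| x y].
- by rewrite dimvf.
- by rewrite !lfunE => /val_inj.
- apply/vspaceP=> u; apply/memv_imgP/idP=> [[x _ ->]|uB].
    by rewrite lfunE; exact: valP.
  by exists (Subvs uB); rewrite ?memvf ?lfunE.
- by rewrite lfunE; exact: vsval1.
by rewrite !lfunE.
Qed.

End FieldSubalgebra.

Lemma mem_span_closed (K : fieldType) (U : vectType K) (S : {pred U}) (s : seq U) :
  submod_closed S -> {subset s <= S} -> {subset <<s>>%VS <= S}.
Proof.
move=> [S0 SD] sS v vs; rewrite (@coord_span _ _ _ (in_tuple s) v vs).
apply: (big_ind (fun x => x \in S)) => // [x y xS yS | i _]; first by rewrite -[x]scale1r SD.
by rewrite -[X in X \in S]addr0 SD // sS // mem_nth.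
Qed.

(** Putting 0 and 1 into b + a (c - b) yields products and 1 - a; finiteness yields inverses, and a
    - b = a (1 - a^-1 b) yields differences. So [A] is a finite division ring, commutative by
    Wedderburn, and it remains to see that it contains the scalars of [F]. *)
Lemma spread_set_field (F : finFieldType) (n : nat) (A : {set 'M[F]_n}) :
    (2 < #|F|)%N -> (0 < n)%N -> #|A| = (#|F| ^ n)%N -> 0 \in A -> 1%:M \in A ->
    {in A &, forall a b, a != b -> a - b \in unitmx} ->
    {in A & &, forall a b c, b + a *m (c - b) \in A} ->
  exists (K : fieldExtType F) (r : 'Hom(K, 'M[F]_n)),
    [/\ \dim {:K} = n, injective r, A =i limg r, r 1 = 1%:M
      & {morph r : x y / x * y >-> x *m y}].
Proof.
case: n A => // m A F_gt2 _ cardA A0; rewrite -[1%:M]/1 => A1 A_subunit A_mx_line.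
have A_line : {in A & &, forall a b c, b + a * (c - b) \in A} := A_mx_line.
have A_unit : {in A, forall a, a != 0 -> a \is a GRing.unit}.
  by move=> a aA a0; rewrite -[a]subr0; apply: A_subunit.
have A_mul a c : a \in A -> c \in A -> a * c \in A.
  by move=> aA cA; have := A_line a 0 c aA A0 cA; rewrite subr0 add0r.
have A_1sub a : a \in A -> 1 - a \in A.
  by move=> aA; have := A_line a 1 0 aA A1 A0; rewrite sub0r mulrN1.
have A_inv a : a \in A -> a != 0 -> a^-1 \in A.
  move=> aA a0; have aU := A_unit a aA a0.
  have : [set a * x | x in A] == A.
    rewrite eqEcard card_imset ?leqnn ?andbT; last exact: mulrI.
    by apply/subsetP=> _ /imsetP[x xA ->]; apply: A_mul.
  move/eqP/setP/(_ 1); rewrite A1 => /imsetP[x xA e].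
  by rewrite -[a^-1]mulr1 e mulKr.
have A_sub' a b : a \in A -> b \in A -> a != 0 -> a - b \in A.
  move=> aA bA a0; have aU := A_unit a aA a0.
  have -> : a - b = a * (1 - a^-1 * b) by rewrite mulrBr mulr1 mulVKr.
  by rewrite A_mul ?A_1sub ?A_mul ?A_inv.
(* Since [A] has more than two elements, [a] can avoid 0 and [b]; then -b = (a - b) - a uses only
   differences whose first term is nonzero. *)
have A_opp b : b \in A -> - b \in A.
  move=> bA; have /set0Pn[a] : A :\: [set 0; b] != set0.
    rewrite -card_gt0 cardsD subn_gt0 cardA.
    apply: leq_ltn_trans (subset_leq_card (subsetIr _ _)) _.
    rewrite cards2; apply: leq_ltn_trans (_ : _ <= 2)%N _; first by case: eqP.
    by rewrite expnS (leq_trans F_gt2) // leq_pmulr // expn_gt0 (ltn_trans _ F_gt2).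
  rewrite !inE negb_or => /andP[/andP[a0 ab] aA].
  have -> : - b = (a - b) - a by rewrite addrAC subrr sub0r.
  by rewrite A_sub' ?subr_eq0 // A_sub'.
have A_sub : GRing.subr_closed A.
  move=> a b aA bA; have [->|a0] := eqVneq a 0; last exact: A_sub'.
  by rewrite sub0r A_opp.
have A_div : GRing.divr_2closed A.
  move=> a b aA bA; have [->|b0] := eqVneq b 0; first by rewrite invr0 mulr0.
  by rewrite A_mul ?A_inv.
have A_comm : {in A &, commutative *%R}.
  by apply: finite_division_subring_comm => //; split.
(* Applying matrices to a nonzero row [v] maps [A] bijectively onto the rows. The element of [A]
   that agrees with the scalar at [v] commutes with [A], so it agrees with the scalar at every
   row. *)
have A_scalar c : c%:M \in A.
  pose v : 'rV[F]_m.+1 := delta_mx 0 0.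
  have v0 : v != 0 by apply/negP=> /eqP/matrixP/(_ 0 0); rewrite !mxE eqxx => /eqP;
    rewrite oner_eq0.
  have v_inj : {in A &, injective (fun a : 'M[F]_m.+1 => v *m a)}.
    move=> a b aA bA /= e; apply: contraNeq v0 => ab.
    have U : a - b \in unitmx by apply: A_unit; rewrite ?subr_eq0 ?A_sub.
    by rewrite -(mulmxK U v) mulmxBr e subrr mul0mx.
  have /eqP v_surj : [set v *m a | a in A] == setT.
    rewrite eqEcard subsetT cardsT card_in_imset //.
    by rewrite cardA card_mx mul1n leqnn.
  have v_gen (w : 'rV_m.+1) : exists2 a, a \in A & w = v *m a.
    by have := in_setT w; rewrite -v_surj => /imsetP.
  have [a aA ea] := v_gen (v *m c%:M).
  suff -> : c%:M = a by [].
  apply/row_matrixP=> i; rewrite !rowE; have [b bA ->] := v_gen (delta_mx 0 i).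
  rewrite -!mulmxA -[b *m a](A_comm _ _ aA bA) scalar_mxC !mulmxA ea.
  by rewrite -!mulmxA.
pose B := <<enum A>>%VS.
have memB a : (a \in B) = (a \in A).
  apply/idP/idP=> [|aA]; last by rewrite memv_span ?mem_enum.
  apply: mem_span_closed => [|x]; last by rewrite mem_enum.
  split=> // c x y xA yA; rewrite -mul_scalar_mx -[y]opprK A_sub ?A_opp //.
  exact: A_mul.
have B_aspace : is_aspace B.
  rewrite /is_aspace has_algid1 ?memB //=.
  by apply/prodvP=> a b; rewrite !memB; apply: A_mul.
have [||| K [r [dimK r_inj imr r1 rM]]] := @field_of_subalgebra _ _ (ASpace B_aspace).
- by rewrite memB.
- by move=> a b; rewrite !memB; apply: A_comm.
- by move=> a; rewrite memB; apply: A_unit.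
exists K, r; split=> // [|a]; last by rewrite imr memB.
rewrite dimK; apply: (@expnI #|F|); first exact: ltn_trans F_gt2.
by rewrite -cardA -(card_vspace B); apply: eq_card.
Qed.

Section Desarguesian.
Variables (F : finFieldType) (U : vectType F) (n : nat) (I : finType).
Variable P : I -> {vspace U}.
Let N := (#|F| ^ n)%N.
Hypotheses (F_gt2 : (2 < #|F|)%N) (n_gt0 : (0 < n)%N).
Hypotheses (dimU : \dim {:U} = (3 * n)%N) (dimP : forall i, \dim (P i) = n).
Hypothesis disjP : forall i j, i != j -> (P i :&: P j = 0)%VS.
Hypothesis cardI : #|I| = (N * N)%N.
Hypothesis card_line : forall i j, i != j -> #|span_line P i j| = N.

(* [A] and [B] are the affine coordinates of the points, as matrices acting on
   the first of the three coordinates in ['rV[F]_n]. *)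
Lemma affine_spread_set i j l : i != j -> l \notin span_line P i j ->
  exists (f0 f1 f2 : 'Hom('rV[F]_n, U)) (A B : I -> 'M[F]_n) (S : {set 'M[F]_n}),
  [/\ [/\ forall x y z, f0 x + f1 y + f2 z = 0 -> [/\ x = 0, y = 0 & z = 0],
      forall u, exists x y z, u = f0 x + f1 y + f2 z &
      forall k x y z, (f0 x + f1 y + f2 z \in P k) = (y == x *m A k) && (z == x *m B k)],
      [/\ A i = 0 /\ B i = 0, A j = 1%:M /\ B j = 0 & A l = 0 /\ B l = 1%:M],
      [/\ #|S| = N, forall k, A k \in S /\ B k \in S
        & {in S &, forall a b, exists k, A k = a /\ B k = b}],
      {in S &, forall a b, a != b -> a - b \in unitmx}
    & {in S & &, forall a b c, b + a *m (c - b) \in S}].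
Proof.
move=> ij lij.
have [f0 [f1 [f2 [A [B [eq0 surj memP [Ai Aj Al] proj]]]]]] :=
  affine_coordinates F_gt2 n_gt0 dimU dimP disjP cardI card_line ij lij.
have memk k x : f0 x + f1 (x *m A k) + f2 (x *m B k) \in P k by rewrite memP !eqxx.
have f_eq x y z x' y' z' : f0 x + f1 y + f2 z = f0 x' + f1 y' + f2 z' ->
    [/\ x = x', y = y' & z = z'].
  move=> e; have [|/subr0_eq-> /subr0_eq-> /subr0_eq-> //] := eq0 (x - x') (y - y') (z - z').
  rewrite !linearB /=; apply/eqP.
  rewrite [X in X + _]addrACA -opprD addrACA -opprD subr_eq0; exact/eqP.
have AB_inj k k' : A k = A k' -> B k = B k' -> k = k'.
  move=> eA eB; apply: contraTeq isT => kk'.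
  have : (P k <= P k :&: P k')%VS.
    apply/subvP=> u uk; rewrite memv_cap uk /=; move: uk; have [x [y [z ->]]] := surj u.
    by rewrite !memP eA eB.
  by rewrite disjP // subv0 -dimv_eq0 dimP; move: n_gt0; lia.
pose S := [set A k | k in I]; pose T := [set B k | k in I].
have AS k : A k \in S by rewrite imset_f.
have BT k : B k \in T by rewrite imset_f.
have il : i != l by apply: contraNneq lij => <-; rewrite inE addvSl.
have zero_line k : B k = 0 -> k \in span_line P i j.
  move=> Bk; rewrite inE; apply/subvP=> u; have [x [y [z ->]]] := surj u.
  rewrite memP Bk mulmx0 => /andP[/eqP ey /eqP->].
  have -> : f0 x + f1 y + f2 0 = (f0 (x - y) + f1 0 + f2 0) + (f0 y + f1 y + f2 0).
    by rewrite !linear0 !addr0 addrA -linearD subrK.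
  by rewrite memv_add // memP ?Ai.1 ?Ai.2 ?Aj.1 ?Aj.2 !mulmx0 ?mulmx1 !eqxx.
have zero_line' k : A k = 0 -> k \in span_line P i l.
  move=> Bk; rewrite inE; apply/subvP=> u; have [x [y [z ->]]] := surj u.
  rewrite memP Bk mulmx0 => /andP[/eqP-> /eqP ez].
  have -> : f0 x + f1 0 + f2 z = (f0 (x - z) + f1 0 + f2 0) + (f0 z + f1 0 + f2 z).
    by rewrite !linear0 !addr0 addrA -linearD subrK.
  by rewrite memv_add // memP ?Ai.1 ?Ai.2 ?Al.1 ?Al.2 !mulmx0 ?mulmx1 !eqxx.
(* By the projection onto the axis [i j], every value of [A] is attained at one of the [N] points of
   that axis. *)
have leS : (#|S| <= N)%N.
  rewrite -(card_line ij); apply: leq_trans (leq_imset_card A _); apply/subset_leq_card.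
  apply/subsetP=> _ /imsetP[k _ ->]; have [_ [a [<- Ba]]] := proj k.
  by rewrite imset_f ?zero_line.
have leT : (#|T| <= N)%N.
  rewrite -(card_line il); apply: leq_trans (leq_imset_card B _); apply/subset_leq_card.
  apply/subsetP=> _ /imsetP[k _ ->]; have [[a [Aa <-]] _] := proj k.
  by rewrite imset_f ?zero_line'.
pose AB k := (A k, B k).
have AB_injective : injective AB by move=> k k' [eA eB]; exact: AB_inj.
have subE : [set AB k | k in I] \subset setX S T.
  by apply/subsetP=> _ /imsetP[k _ ->]; rewrite inE /= AS BT.
have cardE : #|[set AB k | k in I]| = (N * N)%N by rewrite card_imset.
have leE := subset_leq_card subE; rewrite cardE cardsX in leE.
have N_gt0 : (0 < N)%N by rewrite expn_gt0 (ltn_trans _ F_gt2).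
(* The N^2 distinct pairs (A k, B k) lie in a product of two sets of size at most [N], so both
   bounds are attained and every pair occurs. *)
have cardS : #|S| = N by move: leS leT leE N_gt0; nia.
have cardT : #|T| = N by move: leS leT leE N_gt0; nia.
have /eqP eE : [set AB k | k in I] == setX S T.
  by rewrite eqEcard subE cardE cardsX cardS cardT leqnn.
have exAB a b : a \in S -> b \in T -> exists k, A k = a /\ B k = b.
  move=> aS bT; have : (a, b) \in setX S T by rewrite inE /= aS.
  by rewrite -eE => /imsetP[k _ [-> ->]]; exists k.
have S0 : 0 \in S by rewrite -Ai.1.
have S1 : 1%:M \in S by rewrite -Aj.1.
have T0 : 0 \in T by rewrite -Ai.2.
have T1 : 1%:M \in T by rewrite -Al.2.
(* The points of the line through (0, b) and (1, c) have the form (a, b + a (c - b)). There are [N]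
   of them, with distinct first coordinates, so every [a] in [S] occurs. *)
have T_line a b c : a \in S -> b \in T -> c \in T -> b + a *m (c - b) \in T.
  move=> aS bT cT; have [k1 [A1 B1]] := exAB _ _ S0 bT; have [k2 [A2 B2]] := exAB _ _ S1 cT.
  have k12 : k1 != k2.
    apply/eqP=> e; have [x /negP[]] := rV_neq0_exists F n_gt0; apply/eqP.
    by rewrite -[x]mulmx1 -A2 -e A1 mulmx0.
  have Bline k : k \in span_line P k1 k2 -> B k = b + A k *m (c - b).
    move=> kl; apply: mulmx_rV_inj => x.
    move: (memk k x); rewrite inE in kl; move/(subvP kl)/memv_addP=> [u uk1 [v vk2 e]].
    move: uk1 vk2 e; have [x1 [y1 [z1 ->]]] := surj u; have [x2 [y2 [z2 ->]]] := surj v.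
    rewrite !memP A1 B1 A2 B2 mulmx0 mulmx1 => /andP[/eqP-> /eqP->] /andP[/eqP-> /eqP->].
    rewrite addrACA [f0 x1 + _ + _]addrACA -!linearD => /f_eq[ex ey ->].
    rewrite add0r in ey; have -> : x1 = x - x *m A k by rewrite ey ex addrK.
    by rewrite -ey mulmxDr mulmxA mulmxBr mulmxBl -addrA [- _ + _]addrC.
  have /eqP eS : [set A k | k in span_line P k1 k2] == S.
    rewrite eqEcard card_in_imset ?card_line ?cardS ?leqnn ?andbT //.
      by apply/subsetP=> _ /imsetP[k _ ->].
    by move=> k k' kl kl' eA; apply: AB_inj; rewrite // !Bline // eA.
  by move: aS; rewrite -eS => /imsetP[k kl ->]; rewrite -Bline.
have /eqP eST : S == T.
  rewrite eqEcard cardS cardT leqnn andbT; apply/subsetP=> a aS.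
  by have := T_line a 0 1%:M aS T0 T1; rewrite subr0 mulmx1 add0r.
exists f0, f1, f2, A, B, S; split=> //.
- by split=> // [k | a b aS bS]; [rewrite {2}eST | apply: exAB; rewrite -?eST].
(* A row [x] killed by a - b gives the vector (x, x a, 0), common to the points (a, 0) and (b,
   0). *)
- move=> a b aS bS ab; rewrite -row_free_unit -kermx_eq0; apply/rowV0P=> x /sub_kermxP.
  rewrite mulmxBr => /subr0_eq xab.
  have [k [Ak Bk]] := exAB a 0 aS T0; have [k' [Ak' Bk']] := exAB b 0 bS T0.
  have kk' : k != k' by apply: contraNneq ab => e; rewrite -Ak -Ak' e.
  have : f0 x + f1 (x *m a) + f2 0 \in (P k :&: P k')%VS.
    by rewrite memv_cap !memP Ak Bk Ak' Bk' -xab mulmx0 !eqxx.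
  by rewrite disjP // memv0 => /eqP/eq0[].
by move=> a b c aS; rewrite eST; apply: T_line.
Qed.

(** The spread set is a copy of [L] acting on rows. For a fixed nonzero row [v], the bijection t ->
    v r(t) identifies the rows with [L] and turns the matrices into multiplications. *)
Lemma affine_desarguesian i j l : i != j -> l \notin span_line P i j ->
  exists (L : fieldExtType F) (e0 e1 e2 : 'Hom(L, U)) (a b : I -> L),
  [/\ \dim {:L} = n,
      forall x y z, e0 x + e1 y + e2 z = 0 -> [/\ x = 0, y = 0 & z = 0],
      forall k x y z, (e0 x + e1 y + e2 z \in P k) = (y == x * a k) && (z == x * b k),
      forall s t, exists k, a k = s /\ b k = t
    & [/\ a i = 0 /\ b i = 0, a j = 1 /\ b j = 0 & a l = 0 /\ b l = 1]].
Proof.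
move=> ij lij.
have [f0 [f1 [f2 [A [B [S [[eq0 surj memP] [Ai Aj Al] [cardS ABS exAB] S_unit S_line]]]]]]] :=
  affine_spread_set ij lij.
have S0 : 0 \in S by rewrite -Ai.1; case: (ABS i).
have S1 : 1%:M \in S by rewrite -Aj.1; case: (ABS j).
have [L [r [dimL r_inj memS r1 rM]]] := spread_set_field F_gt2 n_gt0 cardS S0 S1 S_unit S_line.
have [v v0] := rV_neq0_exists F n_gt0.
pose h := linfun (mulmx v \o r).
have hE t : h t = v *m r t by rewrite lfunE.
have h_inj : injective h.
  move=> x y; rewrite !hE => e; apply: r_inj; apply: contraNeq v0 => rxy.
  have U' : r x - r y \in unitmx by apply: S_unit; rewrite ?memS ?memv_img ?memvf.
  by rewrite -(mulmxK U' v) mulmxBr e subrr mul0mx.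
have h_surj x : exists t, x = h t.
  have : x \in limg h.
    suff -> : limg h = fullv by exact: memvf.
    apply/eqP; rewrite eqEdim subvf limg_dim_eq ?injective_capker //.
    by rewrite dimL dim_rowspace leqnn.
  by case/memv_imgP=> t _ ->; exists t.
have h_mul s t : h s *m r t = h (s * t) by rewrite !hE rM mulmxA.
have [a ra] : exists a : I -> L, forall k, A k = r (a k).
  have /fin_all_exists[a ea] : forall k, exists t : L, A k = r t.
    by move=> k; have := (ABS k).1; rewrite memS => /memv_imgP[t _ ->]; exists t.
  by exists a.
have [b rb] : exists b : I -> L, forall k, B k = r (b k).
  have /fin_all_exists[b eb] : forall k, exists t : L, B k = r t.
    by move=> k; have := (ABS k).2; rewrite memS => /memv_imgP[t _ ->]; exists t.
  by exists b.
have h_eq0 x : h x = 0 -> x = 0 by rewrite -(linear0 h); apply: h_inj.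
exists L, (f0 \o h)%VF, (f1 \o h)%VF, (f2 \o h)%VF, a, b; split=> // [x y z | k x y z | s t |].
- by rewrite !comp_lfunE => /eq0[/h_eq0-> /h_eq0-> /h_eq0->].
- by rewrite !comp_lfunE memP ra rb !h_mul !(inj_eq h_inj).
- have [||k [As Bt]] := exAB (r s) (r t); rewrite ?memS ?memv_img ?memvf //.
  by exists k; split; apply: r_inj; rewrite -?ra -?rb.
by split; split; apply: r_inj; rewrite -?ra -?rb ?linear0 ?r1;
  first [exact: Ai.1 | exact: Ai.2 | exact: Aj.1 | exact: Aj.2 | exact: Al.1 | exact: Al.2].
Qed.

End Desarguesian.

(** * Good weak eggs *)

Lemma quotient_map (K : fieldType) (V : vectType K) (E : {vspace V}) :
  exists (U : vectType K) (p : 'Hom(V, U)), lker p = E /\ limg p = fullv.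
Proof.
pose C := (E^C)%VS; have capCE : (C :&: E = 0)%VS by rewrite capvC capv_compl.
exists (subvs_of C), (linfun (vsproj C) \o daddv_pi C E)%VF; set p := (_ \o _)%VF.
have pE u : p u = vsproj C (daddv_pi C E u) by rewrite comp_lfunE lfunE.
split.
  apply/vspaceP=> u; rewrite memv_ker pE; apply/eqP/idP => [e | uE].
    have uCE : u \in (C + E)%VS by rewrite addvC addv_complf memvf.
    rewrite -(daddv_pi_add capCE uCE) -(vsprojK (memv_pi C E u)) e linear0 add0r.
    exact: memv_pi.
  suff -> : daddv_pi C E u = 0 by rewrite linear0.
  have uCE : u \in (C + E)%VS by rewrite addvC addv_complf memvf.
  have capEC : (E :&: C = 0)%VS by rewrite capvC.
  have := daddv_pi_add capCE uCE; rewrite (daddv_pi_id capEC uE) => e.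
  by apply: (addIr u); rewrite e add0r.
apply/vspaceP=> w; rewrite memvf; apply/memv_imgP; exists (vsval w); first exact: memvf.
by rewrite pE daddv_pi_id ?subvsP // vsvalK.
Qed.

Lemma sub_limg (K : fieldType) (V U : vectType K) (p : 'Hom(V, U)) (X Y : {vspace V}) :
  (p @: X <= p @: Y)%VS = (X <= lker p + Y)%VS.
Proof.
apply/subvP/subvP=> sub u.
  move=> uX; have /memv_imgP[v vY e] := sub _ (memv_img p uX).
  have uv : u - v \in lker p by rewrite memv_ker linearB /= e subrr.
  by rewrite -[u](subrK v) memv_add.
case/memv_imgP=> x /sub /memv_addP[e]; rewrite memv_ker => /eqP pe [y yY ->] ->.
by rewrite linearD /= pe add0r memv_img.
Qed.

Lemma sum3_independent (K : fieldType) (V : vectType K) (X Y Z : {vspace V}) :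
  \dim (X + Y + Z) = (\dim X + \dim Y + \dim Z)%N ->
  forall x y z, x \in X -> y \in Y -> z \in Z -> x + y + z = 0 ->
  [/\ x = 0, y = 0 & z = 0].
Proof.
move=> d3 x y z xX yY zZ e.
have dXY := dimv_sum_cap X Y; have dXYZ := dimv_sum_cap (X + Y) Z.
have /eqP : \dim (X :&: Y) = 0%N by lia.
have /eqP : \dim ((X + Y) :&: Z) = 0%N by lia.
rewrite !dimv_eq0 => /eqP capZ /eqP capY.
have z0 : z = 0.
  apply/eqP; rewrite -memv0 -capZ memv_cap zZ andbT.
  have -> : z = - (x + y) by apply/eqP; rewrite -addr_eq0 addrC e.
  by rewrite rpredN memv_add.
move: e; rewrite z0 addr0 => e.
have y0 : y = 0.
  apply/eqP; rewrite -memv0 -capY memv_cap yY andbT.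
  have -> : y = - x by apply/eqP; rewrite -addr_eq0 addrC e.
  by rewrite rpredN.
by split=> //; rewrite -e y0 addr0.
Qed.

Lemma egg_independent (F : finFieldType) (n : nat) (EE : {fset {vspace 'rV[F]_(4 * n)}}) :
  weak_egg EE -> forall X Y Z, X \in EE -> Y \in EE -> Z \in EE ->
  X != Y -> X != Z -> Y != Z ->
  forall x y z, x \in X -> y \in Y -> z \in Z -> x + y + z = 0 ->
  [/\ x = 0, y = 0 & z = 0].
Proof.
move=> [_ dimE dim3] X Y Z XE YE ZE XY XZ YZ; apply: sum3_independent.
by rewrite (dim3 _ _ _ XE YE ZE XY XZ YZ) !dimE //; lia.
Qed.

Lemma functional_separation (K : fieldType) (V : vectType K) (u : V) :
  u != 0 -> exists m : 'Hom(V, 'rV[K]_1), m u != 0.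
Proof.
move=> u0; have dim1 : \dim <[u]> = 1%N by rewrite dim_vline u0.
have [f f_inj imf] := subspace_parametrization dim1.
have [m [_ mK]] := partial_inverse (injective_capker fullv f_inj); exists m.
have : u \in limg f by rewrite imf memv_line.
case/memv_imgP=> x _ ux; rewrite ux mK ?memvf //.
by apply: contraNneq u0 => x0; rewrite ux x0 linear0.
Qed.

Lemma card_finvect (F : finFieldType) (U : vectType F) :
  #|finvect_type U| = (#|F| ^ \dim {:U})%N.
Proof.
rewrite -card_vspace_set -cardsT; apply: eq_card => u.
by rewrite in_setT in_set; apply/esym; exact: memvf.
Qed.

(** For a nonzero functional [th], the map sending c to t -> th (c t) is injective, and [L] and its
    dual have the same size. It turns functionals of the maps g into elements of [L]. *)
Lemma functional_representation (F : finFieldType) (L : fieldExtType F) :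
  exists th : 'Hom(L, 'rV[F]_1),
   (forall m : 'Hom(L, 'rV[F]_1), exists c, forall t, m t = th (c * t)) /\
   (forall c, (forall t, th (c * t) = 0) -> c = 0).
Proof.
have [f f_inj _] := subspace_parametrization (dimv1 L).
have [th [_ thK]] := partial_inverse (injective_capker fullv f_inj).
have th_inj c : (forall t, th (c * t) = 0) -> c = 0.
  move=> thc; apply: contraTeq isT => c0.
  have := thc (c^-1 * f (const_mx 1)); rewrite mulVKf // thK ?memvf // => /matrixP/(_ 0 0).
  by rewrite !mxE => /eqP; rewrite oner_eq0.
exists th; split=> // m.
pose M (c : finvect_type L) : finvect_type 'Hom(L, 'rV[F]_1) := (th \o amull (c : L))%VF.
have ME c t : (M c : 'Hom(L, 'rV[F]_1)) t = th ((c : L) * t) by rewrite comp_lfunE lfunE.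
have M_inj : injective M.
  move=> c c' e; apply: subr0_eq; apply: th_inj => t.
  by rewrite mulrBl linearB /= -!ME e subrr.
have leM : (#|finvect_type 'Hom(L, 'rV[F]_1)| <= #|finvect_type L|)%N.
  by rewrite !card_finvect !dimvf /dim /= !muln1 leqnn.
have /codomP[c ->] := inj_card_onto M_inj leM m.
by exists c => t; rewrite -ME.
Qed.

Lemma in_elements (F : finFieldType) (n : nat) (EE : {fset {vspace 'rV[F]_(4 * n)}})
    (X S : {vspace 'rV[F]_(4 * n)}) :
  (X \in elements_in EE S) = (X \in EE) && (X <= S)%VS.
Proof. by rewrite /elements_in !inE. Qed.

Section GoodElement.
Variables (F : finFieldType) (n : nat) (EE : {fset {vspace 'rV[F]_(4 * n)}}).
Variables (E : {vspace 'rV[F]_(4 * n)}) (U : vectType F) (p : 'Hom('rV[F]_(4 * n), U)).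
Hypotheses (egg : weak_egg EE) (E_EE : E \in EE) (E_good : good_at EE E).
Hypotheses (kerp : lker p = E) (imp : limg p = fullv).

Let I : finType := (EE `\ E)%fset.
Definition projected (k : I) : {vspace U} := (p @: val k)%VS.

Let in_EE (k : I) : val k \in EE.
Proof. by have := valP k; rewrite in_fsetD1 => /andP[]. Qed.
Let neq_E (k : I) : E != val k.
Proof. by have := valP k; rewrite in_fsetD1 eq_sym => /andP[]. Qed.
Let E_neq (k : I) : val k != E. Proof. by rewrite eq_sym neq_E. Qed.
Let neq_val (i j : I) : i != j -> val i != val j. Proof. by rewrite (inj_eq val_inj). Qed.
Let dimE X : X \in EE -> \dim X = n. Proof. by case: egg => _ + _; apply. Qed.
Let dim3 (i j : I) : i != j -> \dim (E + val i + val j) = (3 * n)%N.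
Proof. by move=> ij; case: egg => _ _ ->; rewrite ?in_EE ?neq_E ?(inj_eq val_inj). Qed.

Lemma dim_quotient : \dim {:U} = (3 * n)%N.
Proof.
have := limg_ker_dim p fullv; rewrite capfv kerp imp dimE // dim_rowspace; lia.
Qed.

Let capE (i j : I) : i != j -> ((val i + val j) :&: lker p = 0)%VS.
Proof.
move=> ij; apply/eqP; rewrite -subv0; apply/subvP=> u; rewrite kerp.
move=> /memv_capP[/memv_addP[x xi [y yj ->]] uE]; rewrite memv0.
have [] := egg_independent egg (in_EE i) (in_EE j) E_EE (neq_val ij) (E_neq i)
  (E_neq j) xi yj (_ : - (x + y) \in E).
- by rewrite rpredN.
- by rewrite subrr.
by move=> -> -> _; rewrite addr0.
Qed.

Lemma card_other : #|I| = (#|F| ^ n * #|F| ^ n)%N.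
Proof.
rewrite -expnD addnn -mul2n; case: egg => cardE _ _.
by move: cardE; rewrite -cardfE (cardfsD1 E) E_EE add1n addn1 => -[].
Qed.

Lemma projected_dim (k : I) : (0 < n)%N -> (2 < #|F|)%N -> \dim (projected k) = n.
Proof.
move=> n_gt0 F_gt2; have [j jk] : exists j : I, j != k.
  have : (0 < #|[set~ k]|)%N.
    rewrite cardsC1 card_other; have : (1 < #|F| ^ n)%N.
      by rewrite -(exp1n n) ltn_exp2r // ltnW.
    nia.
  by case/card_gt0P=> j; rewrite !inE => jk; exists j.
rewrite limg_dim_eq ?dimE //; apply/eqP.
by rewrite -subv0 -(capE jk) capvS // addvSr.
Qed.

Lemma projected_disjoint (i j : I) : i != j -> (projected i :&: projected j = 0)%VS.
Proof.
move=> ij; apply/eqP; rewrite -subv0; apply/subvP=> u.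
move=> /memv_capP[/memv_imgP[x xi ->] /memv_imgP[y yj e]].
have : x - y \in ((val i + val j) :&: lker p)%VS.
  by rewrite memv_cap memv_add ?rpredN // memv_ker linearB /= e subrr.
rewrite (capE ij) => xy0.
have xy : x = y by apply: subr0_eq; apply/eqP; rewrite -memv0.
rewrite -xy in yj.
have [] := egg_independent egg (in_EE i) (in_EE j) E_EE (neq_val ij) (E_neq i)
  (E_neq j) xi (_ : - x \in val j) (mem0v E).
- by rewrite rpredN.
- by rewrite addr0 subrr.
by move=> -> _ _; rewrite linear0 mem0v.
Qed.

Lemma projected_line (i j k : I) :
  (k \in span_line projected i j) = (val k <= E + val i + val j)%VS.
Proof. by rewrite inE -limgD sub_limg kerp addvA. Qed.

(** This is where goodness enters: the points of the line are the elements other than [E] in the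
    span of [E], [i] and [j], so there are q^n + 1 - 1 of them. *)
Lemma projected_card_line (i j : I) : i != j ->
  #|span_line projected i j| = (#|F| ^ n)%N.
Proof.
move=> ij; set S := (E + val i + val j)%VS.
have ES : (E <= S)%VS by rewrite /S -addvA addvSl.
have iS : (val i <= S)%VS by rewrite /S -addvA (subv_trans _ (addvSr _ _)) ?addvSl.
have jS : (val j <= S)%VS by rewrite addvSr.
have e : [fset val k | k in span_line projected i j]%fset = (elements_in EE S `\ E)%fset.
  apply/fsetP=> X; rewrite in_fsetD1 in_elements; apply/imfsetP/and3P.
    by case=> k /= kl ->; rewrite -projected_line eq_sym neq_E in_EE.
  case=> XE XEE XS; have XI : X \in (EE `\ E)%fset by rewrite in_fsetD1 XE.
  by exists [` XI]%fset; rewrite //= projected_line.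
have card_e : #|` (elements_in EE S `\ E)%fset| = #|span_line projected i j|.
  by rewrite -e card_imfset /= -?cardE //; exact: val_inj.
have := E_good (dim3 ij) ES; rewrite -/S card_e.
rewrite (cardfsD1 E) in_elements E_EE ES card_e addnC => goodS.
apply/eqP; rewrite -(eqn_add2r 1) goodS //.
apply: (@leq_trans #|[set i; j]|); first by rewrite cards2 ij.
apply/subset_leq_card/subsetP=> k.
by rewrite in_set2 projected_line => /orP[] /eqP->.
Qed.

End GoodElement.

Lemma addr4ACA (V : zmodType) (p q r s p' q' r' s' : V) :
  (p + q + r + s) + (p' + q' + r' + s') = (p + p') + (q + q') + (r + r') + (s + s').
Proof. by rewrite addrACA [X in X + _]addrACA [X in X + _ + _]addrACA. Qed.

(** * Coordinates of the egg over [L] and the common quadratic polynomial *)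

Section EggCoordinates.
Variables (F : finFieldType) (V U : vectType F) (n : nat) (I : finType).
Variables (X : I -> {vspace V}) (p : 'Hom(V, U)) (S : {vspace V}).
Let E := lker p.
Let P k := (p @: X k)%VS.
Hypotheses (F_gt2 : (2 < #|F|)%N) (n_gt0 : (0 < n)%N).
Hypotheses (dimE : \dim E = n) (dimU : \dim {:U} = (3 * n)%N).
Hypotheses (dimX : forall k, \dim (X k) = n) (dimP : forall i, \dim (P i) = n).
Hypothesis dimX3 : forall i j k, i != j -> i != k -> j != k ->
  \dim (X i + X j + X k) = (3 * n)%N.
Hypothesis disjP : forall i j, i != j -> (P i :&: P j = 0)%VS.
Hypothesis cardI : #|I| = (#|F| ^ n * #|F| ^ n)%N.
Hypothesis card_line : forall i j, i != j -> #|span_line P i j| = (#|F| ^ n)%N.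
Hypotheses (dimS : \dim S = (3 * n)%N) (E_S : ~~ (E <= S)%VS).

Let capXE k : (X k :&: E = 0)%VS.
Proof.
have := limg_ker_dim p (X k); rewrite -/(P k) dimP dimX => /eqP.
by rewrite -[X in _ == X]add0n eqn_add2r dimv_eq0 => /eqP.
Qed.

(** [S] is the span of the three elements. If their images were collinear, [S] would lie in
    [E + X i + X j], of dimension at most 3n, hence equal it and contain [E]. *)
Let not_collinear i j k : i != j -> i != k -> j != k ->
  (X i <= S)%VS -> (X j <= S)%VS -> (X k <= S)%VS -> k \notin span_line P i j.
Proof.
move=> ij ik jk iS jS kS; apply: contra E_S; rewrite inE /P -limgD sub_limg addvA -/E => kl.
have d3 := dimX3 ij ik jk; set W := (X i + X j + X k)%VS in d3.
have WS : W = S by apply/eqP; rewrite eqEdim d3 dimS leqnn !subv_add iS jS kS.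
have WE : (W <= E + X i + X j)%VS.
  by rewrite !subv_add kl addvSr (subv_trans (addvSr E _) (addvSl _ _)).
suff -> : S = (E + X i + X j)%VS by rewrite -addvA addvSl.
apply/eqP; rewrite -WS eqEdim WE d3 /=.
have := dimv_sum_cap (E + X i) (X j); have := dimv_sum_cap E (X i).
rewrite !dimX dimE; lia.
Qed.

(** [S] is a complement of [E], so [p] has an inverse [s] into [S], and an inverse [r k] into each
    [X k]. Their difference takes values in [E], and vanishes when [X k] lies in [S]; in coordinates
    it is [g k]. *)
Lemma egg_functions i j l : i != j -> i != l -> j != l ->
    (X i <= S)%VS -> (X j <= S)%VS -> (X l <= S)%VS ->
  exists (L : fieldExtType F) (f0 f1 f2 : 'Hom(L, V)) (a b : I -> L) (g : I -> 'Hom(L, V)),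
  [/\ \dim {:L} = n /\ (forall k t, g k t \in E),
      forall x y z, f0 x + f1 y + f2 z \in E -> [/\ x = 0, y = 0 & z = 0],
      forall k x y z w, w \in E ->
        (f0 x + f1 y + f2 z + w \in X k) = [&& y == x * a k, z == x * b k & w == g k x],
      forall k, (X k <= S)%VS -> forall t, g k t = 0
    & (forall s t, exists k, a k = s /\ b k = t) /\
      [/\ a i = 0 /\ b i = 0, a j = 1 /\ b j = 0 & a l = 0 /\ b l = 1]].
Proof.
move=> ij il jl iS jS lS; have lij := not_collinear ij il jl iS jS lS.
have [L [e0 [e1 [e2 [a [b [dimL eq0 memP surj vals]]]]]]] :=
  affine_desarguesian F_gt2 n_gt0 dimU dimP disjP cardI card_line ij lij.
have imS : (p @: S = fullv)%VS.
  apply/eqP; rewrite eqEsubv subvf.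
  rewrite -(affine_span F_gt2 n_gt0 dimU dimP disjP cardI card_line ij lij).
  by rewrite !subv_add !limgS.
have capSE : (S :&: E = 0)%VS.
  have := limg_ker_dim p S; rewrite imS dimU dimS => /eqP.
  by rewrite -[X in _ == X]add0n eqn_add2r dimv_eq0 => /eqP.
have [s [sS sK]] := partial_inverse capSE.
have ps v : p (s v) = v.
  have : v \in (p @: S)%VS by rewrite imS memvf.
  by case/memv_imgP=> u uS ->; rewrite sK.
have /fin_all_exists[r rP] : forall k, exists r : 'Hom(U, V),
    (forall v, r v \in X k) /\ {in X k, cancel p r}.
  by move=> k; exact: partial_inverse.
have pr k v : v \in P k -> p (r k v) = v.
  by case/memv_imgP=> u uX ->; rewrite (rP k).2.
pose c k : 'Hom(L, U) := (e0 + (e1 \o amulr (a k)) + (e2 \o amulr (b k)))%VF.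
have cE k t : c k t = e0 t + e1 (t * a k) + e2 (t * b k).
  by rewrite !add_lfunE !comp_lfunE !lfunE.
have cP k t : c k t \in P k by rewrite cE memP !eqxx.
pose g k : 'Hom(L, V) := ((r k - s) \o c k)%VF.
have gE k t : g k t = r k (c k t) - s (c k t).
  by rewrite comp_lfunE add_lfunE opp_lfunE.
exists L, (s \o e0)%VF, (s \o e1)%VF, (s \o e2)%VF, a, b, g.
have sum_s x y z : (s \o e0)%VF x + (s \o e1)%VF y + (s \o e2)%VF z = s (e0 x + e1 y + e2 z).
  by rewrite !comp_lfunE !linearD.
split=> // [|x y z|k x y z w wE|k kS t].
- by split=> // k t; rewrite memv_ker gE linearB /= ps pr ?subrr.
- by rewrite sum_s memv_ker ps => /eqP/eq0.
- rewrite sum_s; set v := e0 x + e1 y + e2 z.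
  have pv : p (s v + w) = v by move: wE; rewrite memv_ker linearD /= ps => /eqP->; rewrite addr0.
  apply/idP/and3P=> [vX | [/eqP ey /eqP ez /eqP ew]].
    have : v \in P k by rewrite -pv memv_img.
    rewrite memP => /andP[/eqP ey /eqP ez]; rewrite ey ez !eqxx; split=> //.
    rewrite gE; have <- : v = c k x by rewrite cE -ey -ez.
    by rewrite -{1}pv (rP k).2 // addrAC subrr add0r.
  have ev : v = c k x by rewrite cE /v ey ez.
  by rewrite ew gE -ev addrC subrK (rP k).1.
rewrite gE; have [rX rK] := rP k; have /memv_imgP[u uX ->] := cP k t.
by rewrite rK // sK ?subrr // (subvP kS).
Qed.

Lemma egg_coordinates (i0 i1 i2 i3 i4 : I) : (1 < n)%N -> (2 : F) != 0 ->
    uniq [:: i0; i1; i2; i3; i4] -> (forall k, k \in [:: i0; i1; i2; i3; i4] -> (X k <= S)%VS) ->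
  exists (L : fieldExtType F) (f0 f1 f2 f3 : 'Hom(L, V)) (A B : L),
  let Q (x y : L) := A * (x ^+ 2 - x) + B * (x * y) + (y ^+ 2 - y) in
  [/\ \dim {:L} = n,
      forall x y z t, f0 x + f1 y + f2 z + f3 t = 0 -> [/\ x = 0, y = 0, z = 0 & t = 0],
      forall u v, (u, v) != (0, 0) -> A * u ^+ 2 + B * (u * v) + v ^+ 2 != 0,
      forall x y z t, (f0 x + f1 y + f2 z + f3 t \in E) = [&& x == 0, y == 0 & z == 0]
    & exists a b : I -> L, (forall x y, exists k, a k = x /\ b k = y) /\
      forall k x y z t, (f0 x + f1 y + f2 z + f3 t \in X k) =
        [&& y == x * a k, z == x * b k & t == x * Q (a k) (b k)]].
Proof.
move=> n_gt1 F2 uniq5 le5.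
have [s0 s1 s2 s3 s4] : [/\ (X i0 <= S)%VS, (X i1 <= S)%VS, (X i2 <= S)%VS,
    (X i3 <= S)%VS & (X i4 <= S)%VS].
  by split; apply: le5; rewrite !inE eqxx ?orbT.
move: uniq5; rewrite /= !inE !negb_or -!andbA.
move=> /and5P[n01 n02 n03 n04 /and5P[n12 n13 n14 n23 /and3P[n24 n34 _]]].
have [L [f0 [f1 [f2 [a [b [g [[dimL gE] eq0 memX gS [surj [[a0 b0] [a1 b1] [a2 b2]]]]]]]]]]] :=
  egg_functions n01 n02 n12 s0 s1 s2.
pose u k t := f0 t + f1 (t * a k) + f2 (t * b k) + g k t.
have uX k t : u k t \in X k by rewrite memX ?gE // !eqxx.
have u0 k t : u k t = 0 -> t = 0.
  move=> /eqP; rewrite /u addr_eq0 => /eqP e.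
  by have [] := eq0 t (t * a k) (t * b k); rewrite // e rpredN gE.
have indep i j k t1 t2 t3 : i != j -> i != k -> j != k -> t1 + t2 + t3 = 0 ->
    t1 * a i + t2 * a j + t3 * a k = 0 -> t1 * b i + t2 * b j + t3 * b k = 0 ->
    g i t1 + g j t2 + g k t3 = 0 -> [/\ t1 = 0, t2 = 0 & t3 = 0].
  move=> ij ik jk et ea eb eg.
  have d3 : \dim (X i + X j + X k) = (\dim (X i) + \dim (X j) + \dim (X k))%N.
    by rewrite dimX3 // !dimX !mulSn mul0n addn0 addnA.
  have [] := sum3_independent d3 (uX i t1) (uX j t2) (uX k t3); last first.
    by move=> /u0-> /u0-> /u0->.
  rewrite /u; transitivity (f0 (t1 + t2 + t3) + f1 (t1 * a i + t2 * a j + t3 * a k) +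
    f2 (t1 * b i + t2 * b j + t3 * b k) + (g i t1 + g j t2 + g k t3)).
    by rewrite [X in X + _ = _]addr4ACA addr4ACA !linearD /=.
  by rewrite et ea eb eg !linear0 !addr0.
have ab_inj k k' : a k = a k' -> b k = b k' -> k = k'.
  move=> ea eb; apply: contraTeq isT => kk'.
  pose v k := f0 1 + f1 (1 * a k) + f2 (1 * b k).
  have pv k'' : p (v k'') \in P k''.
    have := memv_img p (uX k'' 1); rewrite /u -/(v k'') linearD /=.
    by have /eqP -> : p (g k'' 1) == 0; rewrite -?memv_ker ?gE // addr0.
  have vv : v k = v k' by rewrite /v ea eb.
  have : p (v k) \in (P k :&: P k')%VS by rewrite memv_cap pv vv pv.
  by rewrite disjP // memv0 -memv_ker => /eq0[/eqP]; rewrite oner_eq0.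
have [kap kapP] : exists kap : L -> L -> I, forall x y, a (kap x y) = x /\ b (kap x y) = y.
  have ex x y : exists k, (a k == x) && (b k == y).
    by have [k [<- <-]] := surj x y; exists k; rewrite !eqxx.
  by exists (fun x y => xchoose (ex x y)) => x y; have /andP[/eqP-> /eqP->] := xchooseP (ex x y).
have kapK k : kap (a k) (b k) = k by apply: ab_inj; case: (kapP (a k) (b k)).
have [th [th_rep th_inj]] := functional_representation L.
(* Each functional [m] condenses the maps [g k] into one function [h] with values in [L]. *)
have rep (m : 'Hom(V, 'rV[F]_1)) : exists h : I -> L, forall k t, m (g k t) = th (h k * t).
  suff /fin_all_exists : forall k, exists c, forall t, m (g k t) = th (c * t) by [].
  by move=> k; have [c hc] := th_rep (m \o g k)%VF; exists c => t; rewrite -hc comp_lfunE.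
have h_zero (m : 'Hom(V, 'rV[F]_1)) h k : (forall k t, m (g k t) = th (h k * t)) ->
    (forall t, m (g k t) = 0) -> h k = 0.
  by move=> mh m0; apply: th_inj => t; rewrite -mh m0.
have L2 := fieldExt_2neq0 L F2.
have cardL : #|finvect_type L| = (#|F| ^ n)%N by rewrite card_finvect dimL.
(* As n > 1, [L] has at least four elements, hence one besides 0, 1 and -1. *)
have [w [w_neq0 w_sqr]] : exists w : L, w != 0 /\ w ^+ 2 != 1.
  have /set0Pn[w] : ~: [set (0 : finvect_type L); 1; -1] != set0.
    rewrite -card_gt0 cardsCs setCK subn_gt0 cardL.
    apply: leq_ltn_trans (_ : _ <= 3)%N _.
      by rewrite (leq_trans (leq_card_setU _ _)) // cards1 cards2; case: eqP.
    have q2 : (2 ^ 2 <= #|F| ^ 2)%N by rewrite leq_exp2r // ltnW.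
    by apply: leq_trans q2 _; rewrite leq_exp2l // ltnW.
  rewrite !inE !negb_or -andbA => /and3P[wn0 wn1 wn2]; exists w; split=> //.
  by rewrite sqrf_eq1 negb_or wn1.
have on_line (m : 'Hom(V, 'rV[F]_1)) h e : (forall k t, m (g k t) = th (h k * t)) ->
    e \in E -> m e != 0 -> forall x y u v : L, (u, v) != (0, 0) ->
  exists a b c : L, a != 0 /\
    forall l, h (kap (x + l * u) (y + l * v)) = a * l ^+ 2 + b * l + c.
  move=> mh eE me x y u' v' uv.
  pose k l := kap (x + l * u') (y + l * v').
  apply: (@function_arc_quadratic (finvect_type L) (fun l => h (k l)) L2) => l1 l2 l3 d12 d13 d23.
  have k_neq l l' : l != l' -> k l != k l'.
    move=> ll'; apply: contraNneq uv => e'.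
    have [[ea eb] [ea' eb']] := (kapP (x + l * u') (y + l * v'), kapP (x + l' * u') (y + l' * v')).
    rewrite -/(k l) in ea eb; rewrite -/(k l') -e' in ea' eb'.
    have ll0 : l - l' != 0 by rewrite subr_eq0.
    rewrite xpair_eqE -(mulrI_eq0 u' (mulfI ll0)) -(mulrI_eq0 v' (mulfI ll0)) !mulrBl.
    rewrite !subr_eq0 -(inj_eq (addrI x)) -[X in _ && X](inj_eq (addrI y)).
    by rewrite -ea -ea' -eb -eb' !eqxx.
  (* The weights l2 - l3, l3 - l1, l1 - l2 cancel the coordinates outside [E], so the egg condition
     makes [W] injective, hence onto [E]. A collinear triple of the graph of [h] would make [m]
     vanish on the image of [W], that is, on [E]. *)
  apply: contraNneq me => e0.
  pose W : 'Hom(L, V) := ((g (k l1) \o amulr (l2 - l3 : L)) + (g (k l2) \o amulr (l3 - l1 : L))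
     + (g (k l3) \o amulr (l1 - l2 : L)))%VF.
  have WE s : W s = g (k l1) (s * (l2 - l3)) + g (k l2) (s * (l3 - l1)) + g (k l3) (s * (l1 - l2)).
    by rewrite !add_lfunE !comp_lfunE !lfunE.
  have W_E s : W s \in E by rewrite WE !rpredD ?gE.
  have W_inj : injective W.
    apply/lker0P; rewrite -subv0; apply/subvP=> s; rewrite memv_ker WE memv0 => /eqP Ws.
    have [|||] := indep _ _ _ _ _ _ (k_neq _ _ d12) (k_neq _ _ d13) (k_neq _ _ d23) _ _ _ Ws.
    - by ring.
    - by rewrite !(kapP _ _).1; ring.
    - by rewrite !(kapP _ _).2; ring.
    by move=> _ _ /eqP; rewrite mulf_eq0 subr_eq0 (negPf d12) orbF.
  have imW : limg W = E.
    apply/eqP; rewrite eqEdim limg_dim_eq ?injective_capker // dimL dimE leqnn andbT.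
    by apply/subvP=> _ /memv_imgP[s _ ->].
  move: eE; rewrite -imW => /memv_imgP[s _ ->].
  rewrite WE !linearD /= !mh -!linearD /=.
  suff -> : h (k l1) * (s * (l2 - l3)) + h (k l2) * (s * (l3 - l1)) +
      h (k l3) * (s * (l1 - l2)) = 0.
    by rewrite linear0.
  transitivity (s * ((l2 - l3) * h (k l1) + (l3 - l1) * h (k l2) + (l1 - l2) * h (k l3))).
    by ring.
  by rewrite [X in s * X]e0 mulr0.
have [g00 g01 g02 g03 g04] : [/\ forall t, g i0 t = 0, forall t, g i1 t = 0,
    forall t, g i2 t = 0, forall t, g i3 t = 0 & forall t, g i4 t = 0].
  by split; apply: gS.
have not_coll i j k l : i != j -> i != k -> j != k -> (forall t, g i t = 0) ->
    (forall t, g j t = 0) -> (forall t, g k t = 0) ->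
    a k = a i + l * (a j - a i) -> b k = b i + l * (b j - b i) -> False.
  move=> ij ik jk gi gj gk ea eb.
  have [||||_ _ /eqP] := indep i j k (1 - l) l (-1) ij ik jk.
  - by ring.
  - by rewrite ea; ring.
  - by rewrite eb; ring.
  - by rewrite gi gj gk !addr0.
  by rewrite oppr_eq0 oner_eq0.
have a3_neq0 : a i3 != 0.
  apply/eqP=> a30; apply: (@not_coll i0 i2 i3 (b i3)) => //.
    by rewrite a30 a0 a2; ring.
  by rewrite b0 b2; ring.
have a4_neq0 : a i4 != 0.
  apply/eqP=> a40; apply: (@not_coll i0 i2 i4 (b i4)) => //.
    by rewrite a40 a0 a2; ring.
  by rewrite b0 b2; ring.
(* Equality would put the points of [i1], at (1, 0), [i3] and [i4] on one line; the case [a i3 = 1]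
   is the vertical line. *)
have det34 : (a i3 - 1) * b i4 != b i3 * (a i4 - 1).
  apply/eqP=> det; have [a31|a31] := eqVneq (a i3) 1.
    have b3 : b i3 != 0 by apply: contraNneq n13 => b3; apply/eqP/ab_inj; rewrite ?a1 ?b1.
    have a41 : a i4 = 1.
      by apply/subr0_eq/(mulfI b3); rewrite -det a31 mulr0 subrr mul0r.
    apply: (@not_coll i1 i3 i4 (b i4 / b i3)) => //; first by rewrite a41 a1 a31; ring.
    by rewrite b1; field.
  have a31' : a i3 - 1 != 0 by rewrite subr_eq0.
  apply: (@not_coll i1 i3 i4 ((a i4 - 1) / (a i3 - 1))) => //; first by rewrite a1; field.
  rewrite b1 subr0 add0r; apply: (mulfI a31'); rewrite det; field.
  exact: a31'.
have [A [B five]] := conic_five_points a3_neq0 a4_neq0 det34.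
pose Q (x y : L) := A * (x ^+ 2 - x) + B * (x * y) + (y ^+ 2 - y).
have k00 : kap 0 0 = i0 by rewrite -{1}a0 -b0 kapK.
have k10 : kap 1 0 = i1 by rewrite -a1 -b1 kapK.
have k01 : kap 0 1 = i2 by rewrite -a2 -b2 kapK.
have conic (m : 'Hom(V, 'rV[F]_1)) h : (forall k t, m (g k t) = th (h k * t)) ->
    ~~ (E <= lker m)%VS -> exists A' B' C' D G H : L,
    [/\ forall x y, h (kap x y) = A' * x ^+ 2 + B' * (x * y) + C' * y ^+ 2 + D * x + G * y + H,
        forall x y, h (kap x y) = C' * Q x y
      & forall u v, (u, v) != (0, 0) -> A' * u ^+ 2 + B' * (u * v) + C' * v ^+ 2 != 0].
  move=> mh /subvPn[e eE]; rewrite memv_ker => me.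
  have hz k : (forall t, g k t = 0) -> h k = 0.
    by move=> gk; apply: (h_zero m h k mh) => t; rewrite gk linear0.
  have [A' [B' [C' [D [G [H [hE aniso]]]]]]] :=
    @quadratic_on_lines_conic _ (fun x y => h (kap x y)) w L2 w_neq0 w_sqr (on_line m h e mh eE me).
  exists A', B', C', D, G, H; split=> // x y.
  apply: (five (fun x y => h (kap x y))) hE _ _ _ _ _ x y.
  - by rewrite k00 hz.
  - by rewrite k10 hz.
  - by rewrite k01 hz.
  - by rewrite kapK hz.
  by rewrite kapK hz.
have form (m : 'Hom(V, 'rV[F]_1)) h : (forall k t, m (g k t) = th (h k * t)) ->
    exists C, forall k, h k = C * Q (a k) (b k).
  move=> mh.
  have [/subvP Em|/(conic m h mh)[A' [B' [C [D [G [H [_ hC _]]]]]]]] := boolP (E <= lker m)%VS.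
    exists 0 => k; rewrite mul0r; apply: (h_zero m h k mh) => t.
    by apply/eqP; rewrite -memv_ker; apply/Em/gE.
  by exists C => k; rewrite -hC kapK.
have aniso u' v' : (u', v') != (0, 0) -> A * u' ^+ 2 + B * (u' * v') + v' ^+ 2 != 0.
  have E0 : vpick E != 0 by rewrite vpick0 -dimv_eq0 dimE -lt0n.
  have [m m0] := functional_separation E0; have [h mh] := rep m.
  have nEm : ~~ (E <= lker m)%VS.
    by apply/subvPn; exists (vpick E); rewrite ?memv_pick // memv_ker.
  have [A' [B' [C' [D [G [H [hE hQ aniso]]]]]]] := conic m h mh nEm.
  (* The second difference below is twice the quadratic part of [h] and also 2 C' times that of [Q];
     hence a zero of the latter is one of the former. *)
  move=> /aniso; apply: contraNneq => q0; apply/eqP/(mulfI L2); rewrite mulr0.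
  transitivity (h (kap u' v') + h (kap (- u') (- v')) - 2 * h (kap 0 0)).
    by rewrite !hE; ring.
  rewrite !hQ /Q; transitivity (2 * C' * (A * u' ^+ 2 + B * (u' * v') + v' ^+ 2)); first by ring.
  by rewrite q0 mulr0.
have A_neq0 : A != 0.
  have := aniso 1 0; rewrite xpair_eqE oner_eq0 => /(_ isT).
  apply: contraNneq => ->; apply/eqP; ring.
(* [Q] takes the nonzero value 2 A at (-1, 0), so rescaling [g ks] gives the fourth coordinate map
   [f3]. *)
pose ks := kap (-1) 0; have [aks bks] := kapP (-1) 0; rewrite -/ks in aks bks.
have Qks : Q (a ks) (b ks) = 2 * A by rewrite /Q aks bks; ring.
pose f3 : 'Hom(L, V) := (g ks \o amulr ((2 * A)^-1 : L)%R)%VF.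
have f3E t : f3 t = g ks (t / (2 * A)) by rewrite comp_lfunE lfunE.
have A2 : 2 * A != 0 by rewrite mulf_neq0.
have g_f3 k t : g k t = f3 (t * Q (a k) (b k)).
  (* Every functional [m] gives h = C Q for some constant [C], so none separates the two sides. *)
  apply/eqP; rewrite -subr_eq0; apply: contraTT isT => /functional_separation[m].
  have [h mh] := rep m; have [C hC] := form m h mh.
  rewrite linearB /= f3E !mh !hC Qks.
  have -> : C * (2 * A) * (t * Q (a k) (b k) / (2 * A)) = C * Q (a k) (b k) * t.
    by field; rewrite A_neq0 L2.
  by rewrite subrr eqxx.
have f3_0 t : f3 t = 0 -> t = 0.
  rewrite f3E => gt; have ks0 : ks != i0.
    by apply/eqP=> e; move: aks; rewrite e a0 => /eqP; rewrite eq_sym oppr_eq0 oner_eq0.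
  have ks1 : ks != i1.
    apply/eqP=> e; move: aks; rewrite e a1 => /eqP; rewrite -subr_eq0 opprK.
    by rewrite (_ : 1 + 1 = 2 :> L) ?(negPf L2).
  (* The points (-1, 0), (0, 0), (1, 0) with weights 1, -2, 1: a zero of [g ks] would be a
     dependency between three elements of the egg. *)
  have [||||/eqP + _ _] := 
    indep ks i0 i1 (t / (2 * A)) (- 2 * (t / (2 * A))) (t / (2 * A)) ks0 ks1 n01.
  - by ring.
  - by rewrite aks a0 a1; ring.
  - by rewrite bks b0 b1; ring.
  - by rewrite gt g00 g01 !addr0.
  by rewrite mulf_eq0 invr_eq0 (negPf A2) orbF => /eqP.
have f3_inj : injective f3.
  by move=> x y e; apply/subr0_eq/f3_0; rewrite linearB /= e subrr.
have f3_E t : f3 t \in E by rewrite f3E gE.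
exists L, f0, f1, f2, f3, A, B; split=> // [x y z t e | x y z t |].
- have [|x0 y0 z0] := eq0 x y z.
    by move/eqP: e; rewrite addr_eq0 => /eqP->; rewrite rpredN.
  by split=> //; apply: f3_0; rewrite -e x0 y0 z0 !linear0 !add0r.
- rewrite rpredDr //; apply/idP/and3P => [/eq0[-> -> ->] // | [/eqP-> /eqP-> /eqP->]].
  by rewrite !linear0 !addr0 mem0v.
exists a, b; split=> // k x y z t.
by rewrite memX // g_f3 (inj_eq f3_inj).
Qed.

End EggCoordinates.

(** * Elliptic quadrics and field reduction *)

Section EllipticQuadric.
Variables (L : fieldType) (A B : L).
Hypothesis L2 : (2 : L) != 0.
Hypothesis aniso : forall u v, (u, v) != (0, 0) -> A * u ^+ 2 + B * (u * v) + v ^+ 2 != 0.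

Definition row4 (x y z t : L) : 'rV[L]_4 := \row_j nth 0 [:: x; y; z; t] j.

Lemma row4P (v : 'rV[L]_4) : exists x y z t, v = row4 x y z t.
Proof.
exists (v 0 (@Ordinal 4 0 isT)), (v 0 (@Ordinal 4 1 isT)), (v 0 (@Ordinal 4 2 isT)),
  (v 0 (@Ordinal 4 3 isT)).
apply/rowP=> -[[|[|[|[|m]]]] lt_m] //; rewrite mxE /=; congr (v 0 _); exact: val_inj.
Qed.

Lemma row4_inj x y z t x' y' z' t' :
  row4 x y z t = row4 x' y' z' t' -> [/\ x = x', y = y', z = z' & t = t'].
Proof.
move/rowP=> e.
have := (e (@Ordinal 4 0 isT), e (@Ordinal 4 1 isT), e (@Ordinal 4 2 isT), e (@Ordinal 4 3 isT)).
by rewrite !mxE /= => -[[[-> ->] ->] ->].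
Qed.

Lemma row4D x y z t x' y' z' t' :
  row4 x y z t + row4 x' y' z' t' = row4 (x + x') (y + y') (z + z') (t + t').
Proof. by apply/rowP=> -[[|[|[|[|m]]]] lt_m] //; rewrite !mxE. Qed.

Lemma row4Z c x y z t : c *: row4 x y z t = row4 (c * x) (c * y) (c * z) (c * t).
Proof. by apply/rowP=> -[[|[|[|[|m]]]] lt_m] //; rewrite !mxE. Qed.

(** The homogenization of t = Q(y, z) by x; its points are to be (1, a, b, Q(a, b)) and (0, 0, 0,
    1). The empty last row is read as zeros. *)
Definition egg_quadric : 'M[L]_4 :=
  \matrix_(i, j) nth 0 (nth [::] [:: [:: 0; A; 1; 1]; [:: 0; - A; - B; 0];
                                     [:: 0; 0; -1; 0]; [::]] i) j.

Lemma quad_form_egg x y z t : quad_form egg_quadric (row4 x y z t)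
  = x * t - (A * (y ^+ 2 - x * y) + B * (y * z) + (z ^+ 2 - x * z)).
Proof.
by rewrite /quad_form !mxE !big_ord_recl !big_ord0 !mxE !big_ord_recl !big_ord0 !mxE /=; ring.
Qed.

Let singular0 y z t : quad_form egg_quadric (row4 0 y z t) = 0 -> y = 0 /\ z = 0.
Proof.
rewrite quad_form_egg => e; apply/pair_equal_spec/eqP; apply: contraTT isT => /aniso.
have -> : A * y ^+ 2 + B * (y * z) + z ^+ 2 = 0 by rewrite -[RHS]oppr0 -e; ring.
by rewrite eqxx.
Qed.

Lemma mem_infinity x y z t :
  (row4 x y z t \in <[row4 0 0 0 1]>%VS) = [&& x == 0, y == 0 & z == 0].
Proof.
apply/vlineP/and3P => [[c] | [/eqP-> /eqP-> /eqP->]].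
  by rewrite row4Z !mulr0 => /row4_inj[-> -> -> _].
by exists t; rewrite row4Z !mulr0 mulr1.
Qed.

Lemma mem_affine x y z t a b c :
  (row4 x y z t \in <[row4 1 a b c]>%VS) = [&& y == x * a, z == x * b & t == x * c].
Proof.
apply/vlineP/and3P => [[k] | [/eqP-> /eqP-> /eqP->]].
  by rewrite row4Z mulr1 => /row4_inj[-> -> -> ->].
by exists x; rewrite row4Z mulr1.
Qed.

(** Anisotropy leaves (0, 0, 0, 1) as the only singular point of the plane x = 0. Any totally
    singular subspace is thus that point, or contains a [u] with x nonzero and is spanned by it. *)
Lemma elliptic_egg_quadric : elliptic egg_quadric.
Proof.
split.
  rewrite /Defs.nondegenerate -row_free_unit -kermx_eq0; apply/rowV0P=> v /sub_kermxP.
  have [x [y [z [t ->]]]] := row4P v => /rowP e.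
  have := (e (@Ordinal 4 0 isT), e (@Ordinal 4 1 isT), e (@Ordinal 4 2 isT), e (@Ordinal 4 3 isT)).
  rewrite !mxE !big_ord_recl !big_ord0 !mxE /= => -[[[e0 e1] e2] e3].
  have x0 : x = 0 by rewrite -e3; ring.
  have e1' : A * y * 2 + B * z = 0 by apply: oppr_inj; rewrite oppr0 -[RHS]e1 x0; ring.
  have e2' : B * y + z * 2 = 0 by apply: oppr_inj; rewrite oppr0 -[RHS]e2 x0; ring.
  have [y0 z0] : y = 0 /\ z = 0.
    apply: (@singular0 _ _ 0); rewrite quad_form_egg; apply: (mulfI L2); rewrite mulr0.
    (* Euler's identity: the partial derivatives weighted by [y] and [z] sum to twice the form. *)
    transitivity (- (y * (A * y * 2 + B * z) + z * (B * y + z * 2))); first by ring.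
    by rewrite e1' e2'; ring.
  have t0 : t = 0 by rewrite -e0 x0 y0 z0; ring.
  by rewrite x0 y0 z0 t0; apply/rowP=> -[[|[|[|[|m]]]] lt_m] //; rewrite !mxE.
have e3_neq0 : row4 0 0 0 1 != 0.
  by apply/eqP=> /rowP/(_ (@Ordinal 4 3 isT)); rewrite !mxE /= => /eqP; rewrite oner_eq0.
split.
  exists <[row4 0 0 0 1]>%VS; last by rewrite dim_vline e3_neq0.
  by move=> _ /vlineP[c ->]; rewrite row4Z quad_form_egg; ring.
move=> U U_sing; suff [w Uw] : exists w, (U <= <[w]>)%VS.
  by rewrite (leq_trans (dimvS Uw)) // dim_vline; case: eqP.
have [U3|/subvPn[u uU]] := boolP (U <= <[row4 0 0 0 1]>)%VS; first by exists (row4 0 0 0 1).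
have [x [y [z [t eu]]]] := row4P u; rewrite eu mem_infinity => nu; exists u.
have x0 : x != 0.
  apply: contraNneq nu => x0; move: (U_sing u uU); rewrite eu x0 => /singular0[-> ->].
  by rewrite !eqxx.
(* Subtracting a multiple of [u] from [v] leaves (0, 0, 0, s). Adding this to [u] changes the form
   by x s, so s = 0. *)
apply/subvP=> v vU; have [x' [y' [z' [t' ev]]]] := row4P v.
have wU : v - (x' / x) *: u \in U by rewrite rpredB ?rpredZ.
have ew : v - (x' / x) *: u = row4 0 (y' - x' / x * y) (z' - x' / x * z) (t' - x' / x * t).
  by rewrite ev eu -scaleNr row4Z row4D !mulNr divfK // subrr.
have [] := singular0 (etrans (congr1 _ (esym ew)) (U_sing _ wU)).
set s := t' - _ in ew => ey ez; rewrite ey ez in ew.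
have sU : row4 0 0 0 s \in U by rewrite -ew.
have := U_sing (u + row4 0 0 0 s) (rpredD uU sU).
rewrite eu row4D !addr0 quad_form_egg mulrDr.
have := U_sing _ uU; rewrite eu quad_form_egg => e0.
rewrite addrAC e0 add0r => /eqP; rewrite mulf_eq0 (negPf x0) /= => /eqP s0.
rewrite -eu; apply/vlineP; exists (x' / x); apply/subr0_eq; rewrite ew s0.
by apply/rowP=> -[[|[|[|[|m]]]] lt_m] //; rewrite !mxE.
Qed.

Lemma quadric_point_egg (P : {vspace 'rV[L]_4}) : quadric_point egg_quadric P <->
  P = <[row4 0 0 0 1]>%VS \/ exists a b,
  P = <[row4 1 a b (A * (a ^+ 2 - a) + B * (a * b) + (b ^+ 2 - b))]>%VS.
Proof.
have line_eq (v w : 'rV[L]_4) : v != 0 -> v \in <[w]>%VS -> <[v]>%VS = <[w]>%VS.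
  move=> v0 vw; apply/eqP; rewrite eqEdim -memvE vw !dim_vline v0; by case: eqP.
have row4_neq0 x y z t : (x != 0) || (t != 0) -> row4 x y z t != 0.
  move=> xt; apply/eqP=> /rowP e; move: xt.
  have := (e (@Ordinal 4 0 isT), e (@Ordinal 4 3 isT)).
  by rewrite !mxE /= => -[-> ->]; rewrite eqxx.
split=> [[dimP sing]|].
  have P0 : vpick P != 0 by rewrite vpick0 -dimv_eq0 dimP.
  have eP : P = <[vpick P]>%VS.
    by apply/eqP; rewrite eq_sym eqEdim -memvE memv_pick dim_vline P0 dimP.
  have := sing _ (memv_pick P); have [x [y [z [t ev]]]] := row4P (vpick P).
  rewrite ev in P0 eP *; have [x0|x0] := eqVneq x 0.
    rewrite x0 => s0; have [y0 z0] := singular0 s0; left; rewrite eP; apply: line_eq => //.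
    by rewrite mem_infinity x0 y0 z0 eqxx.
  rewrite quad_form_egg => /subr0_eq e; right; exists (y / x), (z / x).
  rewrite eP; apply: line_eq => //; rewrite mem_affine ![x * (_ / x)]mulrC !divfK // !eqxx /=.
  by apply/eqP; apply: (mulfI x0); rewrite e; field.
case=> [->|[a [b ->]]]; split; rewrite ?dim_vline ?row4_neq0 ?oner_eq0 ?orbT //.
  by move=> _ /vlineP[c ->]; rewrite row4Z quad_form_egg; ring.
by move=> _ /vlineP[c ->]; rewrite row4Z quad_form_egg; ring.
Qed.

End EllipticQuadric.

(** The four maps assemble into an injection [phi] of L^4 into F^(4n). Both have q^(4n) elements, so
    [phi] is bijective and [psi] is its inverse. *)
Lemma reduction_of_coordinates (F : finFieldType) (L : fieldExtType F) (n : nat)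
    (f0 f1 f2 f3 : 'Hom(L, 'rV[F]_(4 * n))) : \dim {:L} = n ->
    (forall x y z t, f0 x + f1 y + f2 z + f3 t = 0 -> [/\ x = 0, y = 0, z = 0 & t = 0]) ->
  exists psi : reduction_map F L 4 n, bijective psi /\
    forall x y z t, psi (f0 x + f1 y + f2 z + f3 t) = row4 x y z t.
Proof.
move=> dimL f_inj.
pose c (v : 'rV[finvect_type L]_4) m : L := v 0 (inord m).
pose phi (v : 'rV[finvect_type L]_4) := f0 (c v 0%N) + f1 (c v 1%N) + f2 (c v 2) + f3 (c v 3).
have c_row4 x y z t m : (m < 4)%N -> c (row4 x y z t) m = nth 0 [:: x; y; z; t] m.
  by move=> m4; rewrite /c mxE inordK.
have phi_row4 x y z t : phi (row4 x y z t) = f0 x + f1 y + f2 z + f3 t.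
  by rewrite /phi !c_row4.
have phiB v w : phi v - phi w = f0 (c v 0%N - c w 0%N) + f1 (c v 1%N - c w 1%N)
    + f2 (c v 2 - c w 2) + f3 (c v 3 - c w 3).
  by rewrite /phi !linearB /= -!addr4ACA !opprD.
have c_ext (v w : 'rV[L]_4) : (forall m, (m < 4)%N -> c v m = c w m) -> v = w.
  by move=> e; apply/rowP=> j; have := e j (ltn_ord j); rewrite /c inord_val.
have phi_inj : injective phi.
  move=> v w e; have [|e0 e1 e2 e3] := f_inj (c v 0%N - c w 0%N) (c v 1%N - c w 1%N)
    (c v 2 - c w 2) (c v 3 - c w 3).
    by rewrite -phiB e subrr.
  by apply: c_ext => -[|[|[|[|m]]]] // _; apply: subr0_eq.
have phi_surj u : exists v : 'rV[L]_4, phi v = u.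
  have le : (#|{: 'rV[F]_(4 * n)}| <= #|{: 'rV[finvect_type L]_4}|)%N.
    by rewrite !card_mx card_finvect dimL -expnM !mul1n mulnC leqnn.
  by have /codomP[v ->] := inj_card_onto phi_inj le u; exists v.
have /fin_all_exists[psi psiK] := phi_surj.
have phiK v : psi (phi v) = v by apply: phi_inj; rewrite psiK.
have phiD (v w : 'rV[L]_4) : phi (v + w) = phi v + phi w.
  have cD m : c (v + w) m = c v m + c w m by rewrite /c mxE.
  by rewrite /phi !cD !linearD /= addr4ACA.
have phiZ (a : F) (v : 'rV[L]_4) : phi (a%:A *: v) = a *: phi v.
  have cZ m : c (a%:A *: v) m = a *: c v m by rewrite /c mxE mulr_algl.
  by rewrite /phi !cZ !linearZ /= -!scalerDr.
have psi_lin : linear_for ((in_alg L) \; *:%R) psi.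
  by move=> a u v; apply: phi_inj; rewrite psiK phiD phiZ !psiK.
pose psi_mixin := GRing.isLinear.Build F 'rV[F]_(4 * n) 'rV[L]_4 ((in_alg L) \; *:%R) psi psi_lin.
pose psiL : reduction_map F L 4 n := HB.pack psi psi_mixin.
exists psiL; split=> [|x y z t]; first by exists phi => u; rewrite /= ?psiK ?phiK.
by rewrite -phi_row4 /= phiK.
Qed.

Lemma good_egg_classical (F : finFieldType) (n : nat)
    (EE : {fset {vspace 'rV[F]_(4 * n)}}) (E S : {vspace 'rV[F]_(4 * n)}) :
  odd #|F| -> (1 < n)%N -> weak_egg EE -> E \in EE -> good_at EE E ->
  \dim S = (3 * n)%N -> ~~ (E <= S)%VS -> (5 <= #|` elements_in EE S|)%N ->
  classical_egg EE.
Proof.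
move=> oddF n_gt1 egg E_EE E_good dimS nES five.
have n_gt0 : (0 < n)%N by exact: ltnW.
have F2 := odd_card_2neq0 oddF.
have F_gt2 := odd_card_gt2 oddF.
have [U [p [kerp imp]]] := quotient_map E.
pose X (k : (EE `\ E)%fset) : {vspace 'rV[F]_(4 * n)} := val k.
have [_ dimEE dim3] := egg.
have X_EE k : X k \in EE by have := valP k; rewrite in_fsetD1 => /andP[].
have XE k : X k != E by have := valP k; rewrite in_fsetD1 => /andP[].
(* As [S] does not contain [E], all elements inside [S] are indexed here. *)
pose J := [set k | (X k <= S)%VS].
have cardJ : (4 < #|J|)%N.
  apply: leq_trans five _.
  have -> : #|J| = #|` [fset X k | k in J]%fset|.
    by rewrite card_imfset /= -?cardE //; exact: val_inj.
  apply/fsubset_leq_card/fsubsetP=> Y; rewrite in_elements => /andP[YEE YS].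
  have YI : Y \in (EE `\ E)%fset.
    by rewrite in_fsetD1 YEE andbT; apply: contraNneq nES => <-.
  by apply/imfsetP; exists [` YI]%fset; rewrite //= inE.
have [i0 [i1 [i2 [i3 [i4 [uniq5 le5]]]]]] : exists i0 i1 i2 i3 i4,
    uniq [:: i0; i1; i2; i3; i4] /\ forall k, k \in [:: i0; i1; i2; i3; i4] -> (X k <= S)%VS.
  have := enum_uniq J; have := mem_enum J; move: cardJ; rewrite cardE.
  case: (enum J) => [|i0 [|i1 [|i2 [|i3 [|i4 s]]]]] //= _ memJ.
  rewrite -[_ && _]/(uniq ([:: i0; i1; i2; i3; i4] ++ s)) cat_uniq => /andP[u5 _].
  exists i0, i1, i2, i3, i4; split=> // k k5.
  have : k \in [:: i0, i1, i2, i3, i4 & s].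
    by rewrite -[_ :: _]/([:: i0; i1; i2; i3; i4] ++ s) mem_cat k5.
  by rewrite memJ inE.
have dimX3 i j k : i != j -> i != k -> j != k -> \dim (X i + X j + X k) = (3 * n)%N.
  have X_neq k1 k2 : k1 != k2 -> X k1 != X k2 by apply: contra_neq => /val_inj.
  by move=> ij ik jk; apply: (dim3 _ _ _ (X_EE i) (X_EE j) (X_EE k)); apply: X_neq.
have kerS : ~~ (lker p <= S)%VS by rewrite kerp.
have [L [f0 [f1 [f2 [f3 [A [B [dimL f_inj aniso memE [a [b [surj memX]]]]]]]]]]] :=
  @egg_coordinates F _ U n _ X p S F_gt2 n_gt0 (etrans (congr1 _ kerp) (dimEE _ E_EE))
    (dim_quotient egg E_EE kerp imp) (fun k => dimEE _ (X_EE k))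
    (fun k => projected_dim egg E_EE kerp k n_gt0 F_gt2) dimX3
    (projected_disjoint egg E_EE kerp) (card_other egg E_EE)
    (projected_card_line egg E_EE E_good kerp) dimS kerS
    i0 i1 i2 i3 i4 n_gt1 F2 uniq5 le5.
have [psi [psi_bij psiE]] := reduction_of_coordinates dimL f_inj.
have L2 := fieldExt_2neq0 L F2.
have coord u : exists x y z t, u = f0 x + f1 y + f2 z + f3 t.
  have [x [y [z [t e]]]] := row4P (psi u); exists x, y, z, t.
  by apply: (bij_inj psi_bij); rewrite psiE.
have redE (Y : {vspace 'rV[F]_(4 * n)}) (P : {vspace 'rV[L]_4}) :
    (forall x y z t, (f0 x + f1 y + f2 z + f3 t \in Y) = (row4 x y z t \in P)) ->
    field_reduction psi P Y.
  by move=> h u; have [x [y [z [t ->]]]] := coord u; rewrite h psiE.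
have red_inj P Y Y' : field_reduction psi P Y -> field_reduction psi P Y' -> Y = Y'.
  by move=> r r'; apply/vspaceP=> u; rewrite r r'.
have red_E : field_reduction psi <[row4 0 0 0 1]>%VS E.
  by apply: redE => x y z t; rewrite mem_infinity -kerp memE.
have red_X k : field_reduction psi
    <[row4 1 (a k) (b k) (A * (a k ^+ 2 - a k) + B * (a k * b k) + (b k ^+ 2 - b k))]>%VS (X k).
  by apply: redE => x y z t; rewrite mem_affine memX.
exists L, psi, (egg_quadric A B); split=> //; first exact: elliptic_egg_quadric.
move=> Y; split=> [YEE | [P /(quadric_point_egg aniso) + redP]].
  have [->|YE] := eqVneq Y E.
    by exists <[row4 0 0 0 1]>%VS => //; apply/(quadric_point_egg aniso); left.
  have YI : Y \in (EE `\ E)%fset by rewrite in_fsetD1 YE.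
  eexists; last exact: (red_X [` YI]%fset).
  by apply/(quadric_point_egg aniso); right; exists (a [` YI]%fset), (b [` YI]%fset).
case=> [eP|[x [y eP]]].
  by rewrite (red_inj P Y E) // eP.
have [k [ek ek']] := surj x y.
by rewrite (red_inj P Y (X k)) ?X_EE // eP -ek -ek'.
Qed.

(** * Classical eggs are good *)

Lemma fset_ltn_exists (T : choiceType) (A B : {fset T}) :
  (#|` B| < #|` A|)%N -> exists2 x, x \in A & x \notin B.
Proof.
move=> lt; apply/fsubsetPn; apply: contraTN lt => sub.
by rewrite -leqNgt fsubset_leq_card.
Qed.

Section QuadraticForm.
Variables (L : fieldType) (m : nat) (M : 'M[L]_m).

Definition polar (u v : 'rV[L]_m) : L :=
  quad_form M (u + v) - quad_form M u - quad_form M v.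

Let bilin (u v : 'rV[L]_m) : L := (u *m M *m v^T) 0 0.

Let quadE u : quad_form M u = bilin u u. Proof. by []. Qed.

Let bilinDl u v w : bilin (u + v) w = bilin u w + bilin v w.
Proof. by rewrite /bilin !mulmxDl mxE. Qed.

Let bilinDr u v w : bilin w (u + v) = bilin w u + bilin w v.
Proof. by rewrite /bilin linearD mulmxDr mxE. Qed.

Let bilinZl a u v : bilin (a *: u) v = a * bilin u v.
Proof. by rewrite /bilin -!scalemxAl mxE. Qed.

Let bilinZr a u v : bilin u (a *: v) = a * bilin u v.
Proof. by rewrite /bilin linearZ -scalemxAr mxE. Qed.

Lemma quad_form_comb3 p0 p1 p2 x0 x1 x2 :
  quad_form M p0 = 0 -> quad_form M p1 = 0 -> quad_form M p2 = 0 ->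
  quad_form M (x0 *: p0 + x1 *: p1 + x2 *: p2) =
    x0 * x1 * polar p0 p1 + x0 * x2 * polar p0 p2 + x1 * x2 * polar p1 p2.
Proof.
rewrite /polar !quadE !(bilinDl, bilinDr) !(bilinZl, bilinZr) => -> -> ->.
ring.
Qed.

(** Otherwise the form would vanish on the whole span of [p0] and [p1], of dimension 2. *)
Lemma polar_neq0 p0 p1 : witt_index M 1 ->
  quad_form M p0 = 0 -> quad_form M p1 = 0 ->
  (forall a b, a *: p0 + b *: p1 = 0 -> a = 0 /\ b = 0) -> polar p0 p1 != 0.
Proof.
move=> [_ witt] q0 q1 indep; apply/eqP=> pol0.
have sing : totally_singular M (<[p0]> + <[p1]>)%VS.
  move=> _ /memv_addP[_ /vlineP[a ->] [_ /vlineP[b ->] ->]].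
  rewrite -[_ + _]addr0 -(scale0r p1) quad_form_comb3 // pol0.
  by rewrite !mulr0 !mul0r !addr0.
have := witt _ sing; rewrite dimv_disjoint_sum.
  have p0_neq0 : p0 != 0.
    apply/eqP=> e; have [] := indep 1 0; rewrite ?e ?scaler0 ?scale0r ?addr0 //.
    by move/eqP; rewrite oner_eq0.
  have p1_neq0 : p1 != 0.
    apply/eqP=> e; have [] := indep 0 1; rewrite ?e ?scaler0 ?scale0r ?addr0 //.
    by move=> _ /eqP; rewrite oner_eq0.
  by rewrite !dim_vline p0_neq0 p1_neq0.
apply/eqP; rewrite -subv0; apply/subvP=> u /memv_capP[/vlineP[a ea] /vlineP[b eb]].
have [] := indep a (- b); first by rewrite scaleNr -ea -eb subrr.
by move=> a0 _; rewrite ea a0 scale0r mem0v.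
Qed.

End QuadraticForm.

Section FieldReduction.
Variables (F : finFieldType) (L : fieldExtType F) (n : nat) (psi : reduction_map F L 4 n).
Hypothesis psi_bij : bijective psi.
Implicit Types (P Q : {vspace 'rV[L]_4}) (X Y : {vspace 'rV[F]_(4 * n)}).

Lemma field_reduction_exists P : exists X, field_reduction psi P X.
Proof.
pose A := [pred u | psi u \in P]; exists <<enum A>>%VS => u.
apply/idP/idP=> [|uA]; last by rewrite memv_span // mem_enum.
apply: (@mem_span_closed _ _ A) => [|v]; last by rewrite mem_enum.
split; first by rewrite inE linear0 mem0v.
by move=> a v w; rewrite !inE linearP => vP wP; rewrite rpredD // rpredZ.
Qed.

Lemma field_reductionD P Q X Y : field_reduction psi P X -> field_reduction psi Q Y ->
  field_reduction psi (P + Q) (X + Y).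
Proof.
have [phi psiK phiK] := psi_bij.
move=> rX rY u; apply/memv_addP/memv_addP => [[x xX [y yY ->]] | [v vP [w wQ e]]].
  by exists (psi x); [rewrite -rX | exists (psi y); rewrite -?rY // linearD].
exists (phi v); first by rewrite rX phiK.
exists (phi w); first by rewrite rY phiK.
by apply: (can_inj psiK); rewrite linearD !phiK.
Qed.

Lemma field_reductionS P Q X Y : field_reduction psi P X -> field_reduction psi Q Y ->
  (X <= Y)%VS = (P <= Q)%VS.
Proof.
have [phi psiK phiK] := psi_bij.
move=> rX rY; apply/subvP/subvP => sub u.
  by move=> uP; rewrite -[u]phiK -rY sub // rX phiK.
by rewrite rX rY; apply: sub.
Qed.

Lemma field_reduction_inj P Q X : field_reduction psi P X -> field_reduction psi Q X -> P = Q.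
Proof.
have [phi psiK phiK] := psi_bij.
by move=> rP rQ; apply/vspaceP=> v; rewrite -[v]phiK -rP -rQ.
Qed.

End FieldReduction.

Section ClassicalEgg.
Variables (F : finFieldType) (n : nat) (EE : {fset {vspace 'rV[F]_(4 * n)}}).
Variables (L : fieldExtType F) (psi : reduction_map F L 4 n) (M : 'M[L]_4).
Hypotheses (egg : weak_egg EE) (dimL : \dim {:L} = n) (psi_bij : bijective psi).
Hypothesis witt : witt_index M 1.
Hypothesis memEE : forall U, U \in EE <->
  exists2 P, quadric_point M P & field_reduction psi P U.

Let generator X : X \in EE ->
  exists v, [/\ v != 0, quad_form M v = 0 & field_reduction psi <[v]> X].
Proof.
move=> /memEE[P [dimP sing] red]; exists (vpick P).
have P0 : vpick P != 0 by rewrite vpick0 -dimv_eq0 dimP.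
split=> //; first exact/sing/memv_pick.
suff <- : P = <[vpick P]>%VS by [].
by apply/eqP; rewrite eq_sym eqEdim -memvE memv_pick dim_vline P0 dimP.
Qed.

Let point_reduction v : v != 0 -> quad_form M v = 0 ->
  exists2 X, X \in EE & field_reduction psi <[v]> X.
Proof.
move=> v0 qv; have [X rX] := field_reduction_exists psi <[v]>%VS; exists X => //.
apply/memEE; exists <[v]>%VS => //; split; first by rewrite dim_vline v0.
move=> _ /vlineP[c ->].
have := @quad_form_comb3 _ _ M v v v c 0 0 qv qv qv.
by rewrite !scale0r !addr0 !mulr0 !mul0r !addr0.
Qed.

(** In the basis [p0], [p1], [p2] the form is a x0 x1 + b x0 x2 + c x1 x2 with nonzero coefficients:
    a conic, whose points correspond to the elements of [L] and one more parameter. *)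
Lemma classical_egg_plane X0 X1 X2 : X0 \in EE -> X1 \in EE -> X2 \in EE ->
  X0 != X1 -> X0 != X2 -> X1 != X2 ->
  #|` elements_in EE (X0 + X1 + X2)| = (#|F| ^ n + 1)%N.
Proof.
move=> X0E X1E X2E n01 n02 n12; have [phi psiK phiK] := psi_bij.
have [p0 [p0_neq0 q0 r0]] := generator X0E; have [p1 [p1_neq0 q1 r1]] := generator X1E.
have [p2 [p2_neq0 q2 r2]] := generator X2E.
have indep a b c : a *: p0 + b *: p1 + c *: p2 = 0 -> [/\ a = 0, b = 0 & c = 0].
  move=> e; have [] := egg_independent egg X0E X1E X2E n01 n02 n12
      (_ : phi (a *: p0) \in X0) (_ : phi (b *: p1) \in X1) (_ : phi (c *: p2) \in X2).
  - by rewrite r0 phiK memvZ ?memv_line.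
  - by rewrite r1 phiK memvZ ?memv_line.
  - by rewrite r2 phiK memvZ ?memv_line.
  - by apply: (can_inj psiK); rewrite !linearD !phiK linear0.
  have scale0 (k : L) (p : 'rV[L]_4) : p != 0 -> phi (k *: p) = 0 -> k = 0.
    move=> p_neq0 /(congr1 psi)/eqP; rewrite phiK linear0 scaler_eq0 (negPf p_neq0) orbF.
    by move/eqP.
  by move=> /scale0-> // /scale0-> // /scale0->.
pose comb x0 x1 x2 := x0 *: p0 + x1 *: p1 + x2 *: p2.
have combZ k x0 x1 x2 : k *: comb x0 x1 x2 = comb (k * x0) (k * x1) (k * x2).
  by rewrite /comb !scalerDr !scalerA.
have comb_inj x0 x1 x2 y0 y1 y2 : comb x0 x1 x2 = comb y0 y1 y2 -> [/\ x0 = y0, x1 = y1 & x2 = y2].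
  move=> e; have [|/subr0_eq-> /subr0_eq-> /subr0_eq-> //] := indep (x0 - y0) (x1 - y1) (x2 - y2).
  rewrite !scalerBl [X in X + _]addrACA -opprD addrACA -opprD; apply/eqP.
  by rewrite subr_eq0; apply/eqP.
set a := polar M p0 p1; set b := polar M p0 p2; set c := polar M p1 p2.
have q_comb x0 x1 x2 : quad_form M (comb x0 x1 x2) = x0 * x1 * a + x0 * x2 * b + x1 * x2 * c.
  exact: quad_form_comb3.
have a_neq0 : a != 0.
  apply: polar_neq0 => // x y e; have [|-> -> //] := indep x y 0.
  by rewrite scale0r addr0.
have b_neq0 : b != 0.
  apply: polar_neq0 => // x y e; have [|-> _ -> //] := indep x 0 y.
  by rewrite scale0r addr0.
have c_neq0 : c != 0.
  apply: polar_neq0 => // x y e; have [|_ -> -> //] := indep 0 x y.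
  by rewrite scale0r add0r.
have comb_neq0 x0 x1 x2 : [|| x0 != 0, x1 != 0 | x2 != 0] -> comb x0 x1 x2 != 0.
  by apply: contraTneq => /indep[-> -> ->]; rewrite eqxx.
(* Projection from [p0] onto the line [p1 p2] parametrizes the conic. *)
pose w (x : L) := comb (- (c * x)) (a + b * x) ((a + b * x) * x).
have w_neq0 x : w x != 0.
  apply: comb_neq0; rewrite oppr_eq0 mulf_eq0 (negPf c_neq0) /=.
  by have [->|//] := eqVneq x 0; rewrite mulr0 addr0 a_neq0 orbT.
have qw x : quad_form M (w x) = 0 by rewrite q_comb; ring.
have p2E : p2 = comb 0 0 1 by rewrite /comb !scale0r !add0r scale1r.
have /fin_all_exists[g gP] : forall x : finvect_type L,
    exists X, X \in EE /\ field_reduction psi <[w x]> X.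
  by move=> x; have [X XE rX] := point_reduction (w_neq0 x) (qw x); exists X.
(* [None] is the parameter at infinity, belonging to [p2]. *)
pose h (o : option (finvect_type L)) := if o is Some x then g x else X2.
have h_inj : injective h.
  have w_g x x' : g x = g x' -> x = x'.
    move=> e; have [_ rx] := gP x; have [_] := gP x'.
    rewrite -e => /(field_reduction_inj psi_bij rx) ex.
    have /vlineP[k] : w x \in <[w x']>%VS by rewrite -ex memv_line.
    rewrite combZ => /comb_inj[e0 e1 _].
    have exk : (x : L) = k * x' by apply: (mulfI c_neq0); apply: oppr_inj; rewrite e0; ring.
    have k1 : k = 1.
      by apply: (mulIf a_neq0); apply: (addIr (b * x)); rewrite mul1r e1 exk; ring.
    by rewrite exk k1 mul1r.
  have g_X2 x : g x <> X2.
    move=> e; have [_] := gP x; rewrite e => /(field_reduction_inj psi_bij)/(_ r2) ex.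
    have /vlineP[k] : w x \in <[p2]>%VS by rewrite -ex memv_line.
    rewrite p2E combZ !mulr0 => /comb_inj[/eqP + /eqP + _].
    rewrite oppr_eq0 mulf_eq0 (negPf c_neq0) /= => /eqP->.
    by rewrite mulr0 addr0 (negPf a_neq0).
  move=> [x|] [x'|] //=; first by move/w_g->.
    by move/g_X2.
  by move/esym/g_X2.
have -> : elements_in EE (X0 + X1 + X2) = [fset h o | o in {: option (finvect_type L)}]%fset.
  have rS := field_reductionD psi_bij (field_reductionD psi_bij r0 r1) r2.
  have comb_S x0 x1 x2 : comb x0 x1 x2 \in (<[p0]> + <[p1]> + <[p2]>)%VS.
    by rewrite !memv_add ?memvZ ?memv_line.
  have same v k X Y : v != 0 -> field_reduction psi <[v]> X -> field_reduction psi <[k]> Y ->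
      v \in <[k]>%VS -> X = Y.
    move=> v0 rX rY vk; apply/vspaceP=> u; rewrite rX rY.
    suff -> : <[v]>%VS = <[k]>%VS by [].
    by apply/eqP; rewrite eqEdim -memvE vk !dim_vline v0; case: eqP.
  apply/fsetP=> Z; rewrite in_elements; apply/andP/imfsetP => [[ZE ZS] | [o _ ->]].
    have [v [v0 qv rv]] := generator ZE.
    move: ZS; rewrite (field_reductionS psi_bij rv rS) -memvE.
    case/memv_addP=> _ /memv_addP[_ /vlineP[x0 ->] [_ /vlineP[x1 ->] ->]] [_ /vlineP[x2 ->] ev].
    rewrite -/(comb x0 x1 x2) in ev; rewrite ev in v0 qv rv.
    rewrite q_comb in qv.
    have [x10|x1_neq0] := eqVneq x1 0.
      move: qv; rewrite x10 mulr0 !mul0r add0r addr0 => /eqP.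
      rewrite !mulf_eq0 (negPf b_neq0) orbF => /orP[/eqP x00|/eqP x20].
        exists None => //=; apply: (same _ _ _ _ v0 rv r2); apply/vlineP; exists x2.
        by rewrite p2E combZ x00 x10 !mulr0 mulr1.
      (* The factor a + b x of [w x] vanishes here, which leaves [p0]. *)
      exists (Some (- (a / b) : finvect_type L)) => //=; have [_ rg] := gP (- (a / b)).
      apply: (same _ _ _ _ v0 rv rg); apply/vlineP; exists (x0 * b / (c * a)).
      rewrite combZ x10 x20; congr comb; field; rewrite ?b_neq0 ?a_neq0 ?c_neq0 //.
    exists (Some (x2 / x1 : finvect_type L)) => //=; have [_ rg] := gP (x2 / x1).
    apply: (same _ _ _ _ v0 rv rg); apply/vlineP.
    (* On the conic, x0 (a x1 + b x2) = - c x1 x2. A zero factor would force x2 = 0, and then a x1 =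
       0. *)
    have d0 : a * x1 + b * x2 != 0.
      apply: contraNneq a_neq0 => d0; have : x1 * x2 * c = 0.
        by rewrite -[RHS]qv -[LHS]add0r -(mulr0 x0) -d0; ring.
      move/eqP; rewrite !mulf_eq0 (negPf x1_neq0) (negPf c_neq0) orbF /= => /eqP x20.
      by move: d0; rewrite x20 mulr0 addr0 => /eqP; rewrite mulf_eq0 (negPf x1_neq0) orbF.
    exists (x1 ^+ 2 / (a * x1 + b * x2)); rewrite combZ; congr comb.
    - have -> : x0 = - (x1 * x2 * c) / (a * x1 + b * x2).
        by apply: (mulIf d0); rewrite divfK // -[LHS]subr0 -qv; ring.
      by field; rewrite x1_neq0.
    - by field; rewrite x1_neq0.
    by field; rewrite x1_neq0.
  case: o => [x|] /=; last by rewrite X2E addvSr.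
  by have [gE rg] := gP x; rewrite gE (field_reductionS psi_bij rg rS) -memvE comb_S.
rewrite card_imfset //= -cardE card_option card_finvect dimL addn1 //.
Qed.

End ClassicalEgg.

(** Every element [E] will do: a (3n - 1)-space on [E] and two more elements is their span, which
    [classical_egg_plane] counts. For [S], take [X3] outside the span of [E], [X1] and [X2]; then
    [X1 + X2 + X3] misses [E] and contains q^n + 1 elements, with q^n at least 9. *)
Lemma classical_egg_good (F : finFieldType) (n : nat) (EE : {fset {vspace 'rV[F]_(4 * n)}}) :
  (2 < #|F|)%N -> (1 < n)%N -> weak_egg EE -> classical_egg EE ->
  exists E : {vspace 'rV[F]_(4 * n)},
     [/\ E \in EE, good_at EE E
       & exists S : {vspace 'rV[F]_(4 * n)},
           [/\ \dim S = (3 * n)%N, ~~ (E <= S)%VS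
             & (5 <= #|` elements_in EE S|)%N]].
Proof.
move=> F_gt2 n_gt1 egg [L [psi [M [dimL psi_bij [_ witt] memEE]]]].
have [cardEE _ dim3] := egg.
have plane := classical_egg_plane egg dimL psi_bij witt memEE.
have q9 : (9 <= #|F| ^ n)%N.
  have q2 : (3 ^ 2 <= #|F| ^ 2)%N by rewrite leq_exp2r.
  by apply: leq_trans q2 _; rewrite leq_exp2l // ltnW.
have cardEE' : #|` EE| = (#|F| ^ n * #|F| ^ n + 1)%N by rewrite cardEE mul2n -addnn expnD.
have big (B : {fset {vspace 'rV[F]_(4 * n)}}) : (#|` B| <= #|F| ^ n + 1)%N ->
    exists2 X, X \in EE & X \notin B.
  move=> leB; apply: fset_ltn_exists; rewrite cardEE'.
  apply: leq_ltn_trans leB _; rewrite ltn_add2r.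
  by rewrite -[X in (X < _)%N]muln1 ltn_pmul2l; apply: leq_trans q9.
have [E EEE _] := big fset0 (leq0n _); exists E.
have [|X1 X1E] := big [fset E]%fset; first by rewrite cardfs1 addn1.
rewrite in_fset1 => X1_E.
have [|X2 X2E] := big [fset E; X1]%fset.
  by rewrite cardfs2; apply: leq_trans (leq_trans _ q9) (leq_addr _ _); case: (_ != _).
rewrite in_fset2 negb_or => /andP[X2_E X2_X1].
have E1 : E != X1 by rewrite eq_sym.
have E2 : E != X2 by rewrite eq_sym.
have X12 : X1 != X2 by rewrite eq_sym.
have [|X3 X3E X3S] := big (elements_in EE (E + X1 + X2)).
  by rewrite plane.
have {X3S} : ~~ (X3 <= E + X1 + X2)%VS by apply: contra X3S => X3S; rewrite in_elements X3E.
move=> X3S; have X3_X1 : X1 != X3.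
  by apply: contraNneq X3S => <-; rewrite (subv_trans (addvSr E _)) ?addvSl.
have X3_X2 : X2 != X3 by apply: contraNneq X3S => <-; rewrite addvSr.
split=> //.
  move=> S dimS ES; rewrite -[(2 <= _)%N]/(1 < _)%N => two.
  have [|Y1] := @fset_ltn_exists _ (elements_in EE S `\ E)%fset fset0.
    by rewrite cardfs0 ltnW.
  rewrite in_fsetD1 in_elements => /and3P[Y1_E Y1E Y1S] _.
  have [|Y2] := @fset_ltn_exists _ (elements_in EE S `\ E)%fset [fset Y1]%fset.
    by rewrite cardfs1.
  rewrite in_fsetD1 in_elements in_fset1 => /and3P[Y2_E Y2E Y2S] Y2_Y1.
  have [EY1 EY2 Y12] : [/\ E != Y1, E != Y2 & Y1 != Y2] by split; rewrite eq_sym.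
  suff -> : S = (E + Y1 + Y2)%VS by rewrite plane.
  by apply/eqP; rewrite eq_sym eqEdim !subv_add ES Y1S Y2S dim3 // dimS leqnn.
exists (X1 + X2 + X3)%VS; split; first by rewrite dim3.
  apply: contra X3S => ES; suff -> : (E + X1 + X2)%VS = (X1 + X2 + X3)%VS by exact: addvSr.
  apply/eqP; rewrite eqEdim !subv_add ES -addvA addvSl addvA.
  by rewrite (subv_trans (addvSr X1 _) (addvSl _ _)) !dim3 ?leqnn.
by rewrite plane // (leq_trans (leq_trans _ q9) (leq_addr _ _)).
Qed.

Theorem corollary4p3 (F : finFieldType) (n : nat)
    (EE : {fset {vspace 'rV[F]_(4 * n)}}) :
  odd #|F| -> (1 < n)%N -> weak_egg EE ->
  (classical_egg EE <->
   exists E : {vspace 'rV[F]_(4 * n)},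
     [/\ E \in EE, good_at EE E
       & exists S : {vspace 'rV[F]_(4 * n)},
           [/\ \dim S = (3 * n)%N, ~~ (E <= S)%VS
             & (5 <= #|` elements_in EE S|)%N]]).
Proof.
move=> oddF n_gt1 egg; split=> [|[E [E_EE E_good [S [dimS nES five]]]]].
  exact: (classical_egg_good (odd_card_gt2 oddF)).
exact: good_egg_classical oddF n_gt1 egg E_EE E_good dimS nES five.
Qed.
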